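(* Let $N,d,k\in\mathbb{N}$ with $k\le d$, let $\theta>0$, and let $a:[0,\infty)\to(0,\infty)$ be non-increasing and Lipschitz with Lipschitz constant $L_a$. Let $x(0)=(x_1(0),\dots,x_N(0))\in(\mathbb{R}^d)^N$ and $v(0)=(v_1(0),\dots,v_N(0))\in(\mathbb{R}^d)^N$ be given. Let $c=1/\sqrt{289}$, $C=\sqrt{72}$, and $$\overline X:=2X(0)+\frac{2N^2}{c^2\theta^2}V(0)^2,\qquad \Delta:=\min\Big(\frac{\gamma(\overline X)}{C},\ \frac12\gamma(4\overline X)\Big),\qquad \hat T:=\frac{2N}{\theta}\big(2\sqrt{V(0)}-2\Delta\big).$$ Let $\tau_0>0$ be so small that $$\tau_0\big(a(0)\sqrt N\sqrt{V(0)}+\theta\big)+\tau_0^2\,a(0)\theta\le\frac{\Delta}{4},$$ and fix $\tau\in(0,\tau_0]$. Let $M\in\mathbb{R}^{k\times d}$. Let $u^h,u^\ell$ be the sparse controls (defined in the context) with threshold $\Gamma=(2\Delta)^2$, and let $(x(t),v(t))$ and $(y(t),w(t))$ be the sampling solutions, associated with the sampling time $\tau$, of the $d$-dimensional and the $k$-dimensional controlled Cucker--Smale systems (see context) with initial conditions $(x(0),v(0))$ and $y_i(0)=Mx_i(0)$, $w_i(0)=Mv_i(0)$ ($i=1,\dots,N$), respectively. Let $\alpha=\frac{\sqrt2\,N}{c\,\theta}$ and let $\varepsilon'\in(0,1)$ be so small that $$\varepsilon'\sqrt N\Big(4L_a\sqrt{NV(0)}\big(\sqrt{2X(0)}+\alpha\big)+\frac{\theta}{\sqrt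 N}\Big)(\hat T+\tau)\,e^{(\hat T+\tau)\left(\max\left(2a(0)+1,\,4L_a\sqrt{NV(0)}\right)+\frac{8\theta}{\Delta}\right)}\le\frac{\Delta}{2}.$$ Assume that the matrix $M$ (JL1) has the weak Johnson--Lindenstrauss property of parameters $\varepsilon=\varepsilon'$ and $\delta=\varepsilon'\frac{\sqrt{2X(0)}+\alpha}{2}$ at all points $x_i(t)-x_j(t)$ for $i,j\in\{1,\dots,N\}$, $t\in[0,\hat T+\tau]$; (JL2) has the weak Johnson--Lindenstrauss property of parameters $\varepsilon=\varepsilon'$ and $\delta=\Delta$ at all points $v_i(n\tau)-\overline v(n\tau)$ for $i\in\{1,\dots,N\}$, $n=0,\dots,\lfloor\hat T/\tau\rfloor+1$; (JL3) has the (strong) Johnson--Lindenstrauss property of parameter $\varepsilon=1/2$ at the points $v_i(0)-\overline v(0)$ and $x_i(0)-\overline x(0)$ for $i\in\{1,\dots,N\}$. Then there exists $n\in\mathbb{N}_0$ such that $\sqrt{W(n\tau)}\le2\Delta$. Moreover, setting $T_0=n^*\tau$ with $n^*:=\min\{n\in\mathbb{N}_0:\sqrt{W(n\tau)}\le2\Delta\}$, at time $T_0$ both the high-dimensional and the projected low-dimensional systems are in the consensus region, i.e. $$\sqrt{V(T_0)}\le\gamma(X(T_0))\quad\text{and}\quad\sqrt{W(T_0)}\le\gamma(Y(T_0)).$$ Furthermore, $$T_0\le\frac{2N}{\theta}\big(\sqrt{W(0)}-2\Delta\big)+\tau\le\hat T+\tau,$$ $$\max_{t\in[0,T_0]}\max_{i,j}\|x_i(t)-x_j(t)\|\le2\sqrt{N\overline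 X},\qquad \max_{t\in[0,T_0]}\max_{i,j}\|v_i(t)-v_j(t)\|\le2\sqrt{NV(0)}.$$
   Context: $\|\cdot\|$ is the Euclidean norm. For a family $z=(z_1,\dots,z_N)$ of vectors, $\overline z=\frac1N\sum_i z_i$ and $z_i^\perp=z_i-\overline z$. $X(t)=\frac1{2N^2}\sum_{i,j}\|x_i(t)-x_j(t)\|^2$, $V(t)=\frac1{2N^2}\sum_{i,j}\|v_i(t)-v_j(t)\|^2=\frac1N\sum_i\|v_i^\perp(t)\|^2$; $Y(t)$ and $W(t)$ are the same quantities for $y(t)$ and $w(t)$. For $X_0\ge0$, $\gamma(X_0):=\int_{\sqrt{X_0}}^{\infty}a(\sqrt{2N}\,r)\,dr$. Johnson--Lindenstrauss properties: for $\varepsilon\in(0,1)$, $M\in\mathbb{R}^{k\times d}$ has the (strong) Johnson--Lindenstrauss property of parameter $\varepsilon$ at $z\in\mathbb{R}^d$ if $(1-\varepsilon)\|z\|\le\|Mz\|\le(1+\varepsilon)\|z\|$. It has the weak Johnson--Lindenstrauss property of parameters $\varepsilon$ and $\delta>0$ at $z$ if either this holds or ($\|z\|\le\delta$ and $\|Mz\|\le\delta$). Controlled systems: the $d$-dimensional one is $\dot x_i=v_i$, $\dot v_i=\frac1N\sum_{j=1}^N a(\|x_i-x_j\|)(v_j-v_i)+u_i^h$, and the $k$-dimensional one is $\dot y_i=w_i$, $\dot w_i=\frac1N\sum_{j=1}^N a(\|y_i-y_j\|)(w_j-w_i)+u_i^\ell$, for $i=1,\dots,N$. Sparse controls with threshold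 $\Gamma\ge0$: let $T_0^c:=\inf\{t\ge0:W(t)\le\Gamma\}$ (and $T_0^c:=+\infty$ if this set is empty). If $t\le T_0^c$, let $\hat\iota(t)$ be the smallest index with $\|w_{\hat\iota(t)}^\perp(t)\|=\max_{1\le i\le N}\|w_i^\perp(t)\|$, and put $u_i^\ell(t)=-\theta\,w_i^\perp(t)/\|w_i^\perp(t)\|$ and $u_i^h(t)=-\theta\,v_i^\perp(t)/\|v_i^\perp(t)\|$ for $i=\hat\iota(t)$, and $u_i^\ell(t)=0$, $u_i^h(t)=0$ for $i\ne\hat\iota(t)$. (The same index $\hat\iota$, computed from the low-dimensional system, is used in both systems.) If $t>T_0^c$, then $u^h(t)=0$ and $u^\ell(t)=0$. Sampling solutions with sampling time $\tau$: the continuous, piecewise $C^1$ solutions of the two systems on $[0,\infty)$ obtained recursively by solving, on each interval $[n\tau,(n+1)\tau]$, $n\in\mathbb{N}_0$, the systems with the controls frozen at the constant values $u^h(n\tau)$ and $u^\ell(n\tau)$, using as initial value at $n\tau$ the endpoint of the solution on the preceding interval.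
   Formalization: The bound T_0 ≤ (2N/θ)(√W(0) − 2Δ) + τ is stated only when √W(0) ≥ 2Δ; otherwise n* = 0, T_0 = 0 and the right side can be negative (e.g. nearly equal v_i(0), M the identity). Δ is taken finite, and a control direction 0/0 is read as 0. *)

(* Defs.v *)
From mathcomp Require Export all_boot all_order all_algebra.
From mathcomp Require Export all_classical all_reals all_analysis.
Export numFieldNormedType.Exports.

Set Implicit Arguments.
Unset Strict Implicit.
Unset Printing Implicit Defensive.

Import Order.TTheory GRing.Theory Num.Theory.

Local Open Scope classical_set_scope.
Local Open Scope ring_scope.

(* The library norm `|z| on matrices is the sup norm, hence this definition. *)
Definition enorm (R : realType) (m : nat) (z : 'cV[R]_m) : R :=
  Num.sqrt (\sum_(l < m) z l ord0 ^+ 2).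

Definition mean (R : realType) (N m : nat) (z : 'I_N -> 'cV[R]_m) : 'cV[R]_m :=
  N%:R^-1 *: \sum_(i < N) z i.

Definition perp (R : realType) (N m : nat) (z : 'I_N -> 'cV[R]_m) (i : 'I_N) :
  'cV[R]_m := z i - mean z.

Definition spread (R : realType) (N m : nat) (z : 'I_N -> 'cV[R]_m) : R :=
  (2 * N%:R ^+ 2)^-1 * \sum_(i < N) \sum_(j < N) enorm (z i - z j) ^+ 2.

(* Extended-real valued: +oo when the tail of a is not integrable. *)
Definition gamma (R : realType) (N : nat) (a : R -> R) (X0 : R) : \bar R :=
  (\int[lebesgue_measure]_(r in `[Num.sqrt X0, +oo[)
     (a (Num.sqrt (2 * N%:R) * r))%:E)%E.

Definition strong_JL (R : realType) (k d : nat) (M : 'M[R]_(k, d))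
    (eps : R) (z : 'cV[R]_d) : Prop :=
  (1 - eps) * enorm z <= enorm (M *m z) /\
  enorm (M *m z) <= (1 + eps) * enorm z.

Definition weak_JL (R : realType) (k d : nat) (M : 'M[R]_(k, d))
    (eps delta : R) (z : 'cV[R]_d) : Prop :=
  strong_JL M eps z \/ (enorm z <= delta /\ enorm (M *m z) <= delta).

Definition alignment (R : realType) (N m : nat) (a : R -> R)
    (p q : 'I_N -> 'cV[R]_m) (i : 'I_N) : 'cV[R]_m :=
  N%:R^-1 *: \sum_(j < N) a (enorm (p i - p j)) *: (q j - q i).

(* The ODE is imposed in the interior of each sampling interval; together with
   continuity on [0, +oo[ this is the same as solving it on the closed interval
   with one-sided derivatives at the endpoints.  The values of p and q at
   negative times are irrelevant. *)
Definition sampling_solution (R : realType) (N m : nat) (a : R -> R) (tau : R)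
    (u : R -> 'I_N -> 'cV[R]_m) (p0 q0 : 'I_N -> 'cV[R]_m)
    (p q : R -> 'I_N -> 'cV[R]_m) : Prop :=
  [/\ forall i : 'I_N, p 0 i = p0 i /\ q 0 i = q0 i,
      forall i : 'I_N, {within `[0, +oo[, continuous (fun t : R => p t i)} /\
                       {within `[0, +oo[, continuous (fun t : R => q t i)}
    & forall (n : nat) (i : 'I_N) (t : R), n%:R * tau < t < n.+1%:R * tau ->
        is_derive t (1 : R) (fun s : R => p s i) (q t i) /\
        is_derive t (1 : R) (fun s : R => q s i)
          (alignment a (p t) (q t) i + u (n%:R * tau) i)].

Definition is_first_max (R : realType) (N m : nat) (z : 'I_N -> 'cV[R]_m)
    (i : 'I_N) : bool :=
  [forall j : 'I_N, enorm (perp z j) <= enorm (perp z i)] &&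
  [forall j : 'I_N, (j < i)%N ==> (enorm (perp z j) < enorm (perp z i))].

Definition switch_off_time (R : realType) (N k : nat) (Gamma : R)
    (w : R -> 'I_N -> 'cV[R]_k) : \bar R :=
  ereal_inf [set t%:E | t in [set t : R | 0 <= t /\ spread (w t) <= Gamma]].

(* Acts on the system with velocities q (q = v or q = w); the switch-off time
   and the controlled index always come from the low-dimensional w.  If the
   perpendicular part of the controlled agent vanishes, the control is 0. *)
Definition sparse_control (R : realType) (N k m : nat) (theta Gamma : R)
    (w : R -> 'I_N -> 'cV[R]_k) (q : R -> 'I_N -> 'cV[R]_m)
    (t : R) (i : 'I_N) : 'cV[R]_m :=
  if (t%:E <= switch_off_time Gamma w)%E && is_first_max (w t) i
  then - (theta / enorm (perp (q t) i)) *: perp (q t) i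
  else 0.

(* Main.v *)
Require Import Defs.
From mathcomp Require Import measurable_realfun ring lra.
Import Order.TTheory GRing.Theory Num.Theory.

Set Implicit Arguments.
Unset Strict Implicit.
Unset Printing Implicit Defensive.

Local Open Scope classical_set_scope.
Local Open Scope ring_scope.

(* As long as W exceeds (2 Delta)^2 at the sampling times, the most deviating agent of
   the low-dimensional system deviates by at least 2 Delta.  By the choice of tau its
   frozen control keeps a definite component towards the mean during the whole sampling
   interval, so sqrt W decreases at rate theta / (2 N); this gives the existence of n
   and the bound on T_0.  The error of the projected trajectory obeys a linear
   differential inequality with delay; the alignment terms are dissipative in the
   l^2 norm of the error, and the smallness of eps makes the error at most Delta / 2
   up to the stopping time.  Hence, by the weak Johnson-Lindenstrauss property, the
   same agent deviates by at least Delta, and by a fifth of sqrt V, in the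
   high-dimensional system, and sqrt V decreases at a rate c theta / (2 N) as well.
   Since sqrt X grows at speed at most sqrt V, the quantities
   sqrt X + N V / (c theta) and sqrt Y + N W / theta do not increase, which gives
   X <= Xbar and Y <= 4 Xbar.  At the stopping time W <= (2 Delta)^2 forces
   V <= 72 Delta^2, and the definition of Delta places both systems in the consensus
   region. *)

(** * Scalar differential inequalities *)

(** The control jumps at the sampling times, so the velocities are differentiable only inside a
    sampling interval; continuity up to the endpoints lets estimates on successive intervals be
    chained. *)
Definition deriv_on (R : realType) (s e : R) (f df : R -> R) : Prop :=
  {within `[s, e], continuous f} /\
  forall t, s < t < e -> is_derive t (1 : R) f (df t).

Section DerivOn.
Context {R : realType}.
Implicit Types (s e : R) (f g df dg : R -> R).

Lemma deriv_onW s e s' e' f df :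
  s <= s' -> e' <= e -> deriv_on s e f df -> deriv_on s' e' f df.
Proof.
move=> ss ee [cf dfP]; split.
  apply: continuous_subspaceW cf => x /=; rewrite !in_itv/= => /andP[? ?].
  by rewrite (le_trans ss)//= (le_trans _ ee).
move=> t /andP[st te]; apply: dfP.
by rewrite (le_lt_trans ss st) (lt_le_trans te ee).
Qed.

Lemma deriv_on_cst s e (c : R) : deriv_on s e (fun=> c) (fun=> 0).
Proof. by split=> [|t _]; [move=> x; exact: cvg_cst|exact: is_derive_cst]. Qed.

Lemma deriv_on_id s e : deriv_on s e id (fun=> 1).
Proof.
split=> [|t _]; last exact: is_derive_id.
by apply: continuous_subspaceT => x; exact: cvg_id.
Qed.

Lemma deriv_onD s e f g df dg : deriv_on s e f df -> deriv_on s e g dg ->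
  deriv_on s e (fun t => f t + g t) (fun t => df t + dg t).
Proof.
move=> [cf hf] [cg hg]; split=> [x|t st].
  by apply: cvgD; [exact: cf|exact: cg].
exact: (is_deriveD (hf _ st) (hg _ st)).
Qed.

Lemma deriv_onM s e f g df dg : deriv_on s e f df -> deriv_on s e g dg ->
  deriv_on s e (fun t => f t * g t) (fun t => df t * g t + f t * dg t).
Proof.
move=> [cf hf] [cg hg]; split=> [x|t st].
  by apply: cvgM; [exact: cf|exact: cg].
apply: is_derive_eq (is_deriveM (hf _ st) (hg _ st)) _.
by rewrite addrC [df t * g t]mulrC.
Qed.

Lemma deriv_on_eq s e f g df dg : f =1 g -> (forall t, s < t < e -> df t = dg t) ->
  deriv_on s e f df -> deriv_on s e g dg.
Proof.
move=> /funext <- dfg [cf hf]; split=> // t st.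
by rewrite -dfg//; exact: hf.
Qed.

Lemma deriv_onZ s e (k : R) f df : deriv_on s e f df ->
  deriv_on s e (fun t => k * f t) (fun t => k * df t).
Proof.
move=> hf; apply: deriv_on_eq (deriv_onM (deriv_on_cst s e k) hf) => // t _.
by rewrite mul0r add0r.
Qed.

Lemma deriv_onB s e f g df dg : deriv_on s e f df -> deriv_on s e g dg ->
  deriv_on s e (fun t => f t - g t) (fun t => df t - dg t).
Proof.
move=> hf /(deriv_onZ (-1)) /(deriv_onD hf).
by apply: deriv_on_eq => t; rewrite mulN1r.
Qed.

Lemma deriv_on_sum s e (I : finType) (f df : I -> R -> R) :
  (forall i, deriv_on s e (f i) (df i)) ->
  deriv_on s e (fun t => \sum_i f i t) (fun t => \sum_i df i t).
Proof.
move=> hf; elim: (index_enum I) => [|i r IH].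
  by apply: deriv_on_eq (deriv_on_cst s e 0) => t; rewrite big_nil.
by apply: deriv_on_eq (deriv_onD (hf i) IH) => t; rewrite big_cons.
Qed.

Lemma deriv_on_comp s e f df (g dg : R -> R) :
  deriv_on s e f df -> (forall t, {for f t, continuous g}) ->
  (forall t, s < t < e -> is_derive (f t) (1 : R) g (dg (f t))) ->
  deriv_on s e (fun t => g (f t)) (fun t => dg (f t) * df t).
Proof.
move=> [cf hf] cg hg; split=> [x|t st].
  by apply: continuous_comp; [exact: cf|exact: cg].
exact: (is_derive1_comp (hg _ st) (hf _ st)).
Qed.

Lemma deriv_on_expZ s e (L : R) :
  deriv_on s e (fun t => expR (L * t)) (fun t => expR (L * t) * L).
Proof.
have := deriv_onZ L (deriv_on_id s e); rewrite /= => h.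
apply: deriv_on_eq (deriv_on_comp h (fun t => @continuous_expR R _)
  (fun t _ => is_derive_expR (L * t))) => // t _.
by rewrite mulr1.
Qed.

Lemma deriv_on_le s e f df (K : R) : s <= e -> deriv_on s e f df ->
  (forall t, s < t < e -> df t <= K) -> f e <= f s + K * (e - s).
Proof.
rewrite le_eqVlt => /predU1P[<-|se] [cf hf] dfK.
  by rewrite subrr mulr0 addr0.
have hf' x : x \in `]s, e[ -> is_derive x (1 : R) f (df x).
  by move=> xse; apply: hf; rewrite !(itvP xse).
have [c cse E] := MVT se hf' cf.
rewrite -lerBlDl E; apply: ler_wpM2r; first by rewrite subr_ge0 ltW.
apply: dfK.
by rewrite !(itvP cse).
Qed.

(* [Num.sqrt \o f] may fail to be differentiable at a zero of [f]; the proof works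
   with [Num.sqrt (f t + eta ^+ 2)] and lets [eta] tend to 0. *)
Lemma deriv_on_sqrt_le s e f df (g : R) : s <= e -> 0 <= g -> (forall t, 0 <= f t) ->
  deriv_on s e f df -> (forall t, s < t < e -> df t <= 2 * g * Num.sqrt (f t)) ->
  Num.sqrt (f e) <= Num.sqrt (f s) + g * (e - s).
Proof.
move=> se g0 f0 hf dfg.
apply/ler_addgt0Pr => eta eta0.
have eta2 : 0 < eta ^+ 2 by rewrite exprn_gt0.
have fp t : 0 < f t + eta ^+ 2 by rewrite ltr_wpDl.
have h := deriv_on_comp (dg := fun y => (2 * Num.sqrt y)^-1)
  (deriv_onD hf (deriv_on_cst s e (eta ^+ 2)))
  (fun t => @sqrt_continuous _ _) (fun t _ => is_derive1_sqrt (fp t)).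
have := deriv_on_le (K := g) se h _.
have -> : (forall t, s < t < e ->
    (2 * Num.sqrt (f t + eta ^+ 2))^-1 * (df t + 0) <= g) = true :> Prop.
  apply/propext; split=> // _ t st; rewrite addr0.
  have sp : 0 < 2 * Num.sqrt (f t + eta ^+ 2) by rewrite mulr_gt0// sqrtr_gt0.
  rewrite ler_pdivrMl// (le_trans (dfg _ st))// mulrAC ler_wpM2r//.
  by rewrite ler_pM2l// ler_wsqrtr// lerDl ltW.
move=> /(_ isT) H; rewrite addrAC.
apply: le_trans (le_trans H _); first by rewrite ler_wsqrtr// lerDl ltW.
rewrite lerD2r.
rewrite -(@ler_pXn2r _ 2)// ?nnegrE ?addr_ge0 ?sqrtr_ge0 ?(ltW eta0)//.
rewrite sqrrD !sqr_sqrtr ?(ltW (fp _))// lerD2r lerDl mulrn_wge0//.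
by rewrite mulr_ge0 ?sqrtr_ge0 ?(ltW eta0).
Qed.

(** Integrating factor: [expR (- L * t) * f t] is non-increasing and has the sign of [f t]. *)
Lemma gronwall_le0 s e f df (L : R) : s <= e -> deriv_on s e f df ->
  (forall t, s < t < e -> df t <= L * f t) -> f s <= 0 -> f e <= 0.
Proof.
move=> se hf dfL fs.
have h := deriv_onM (deriv_on_expZ s e (- L)) hf.
have := deriv_on_le (K := 0) se h.
have /[swap]/[apply] : forall t, s < t < e ->
    expR (- L * t) * - L * f t + expR (- L * t) * df t <= 0.
  move=> t st; rewrite -mulrA -mulrDr pmulr_rle0 ?expR_gt0//.
  by rewrite mulNr addrC subr_le0 dfL.
rewrite mul0r addr0 => H.
have : expR (- L * e) * f e <= 0.
  by rewrite (le_trans H)// pmulr_rle0 ?expR_gt0.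
by rewrite pmulr_rle0 ?expR_gt0.
Qed.

End DerivOn.

(** * Euclidean geometry of finite families *)

(** It serves twice: over the coordinates of two vectors, and over the agents with the norms of
    their deviations. *)
Lemma sum_cauchy_schwarz (R : rcfType) (I : finType) (f g : I -> R) :
  \sum_i f i * g i <= Num.sqrt (\sum_i f i ^+ 2) * Num.sqrt (\sum_i g i ^+ 2).
Proof.
set A := \sum_i f i ^+ 2; set B := \sum_i g i ^+ 2; set C := \sum_i f i * g i.
have A0 : 0 <= A by apply: sumr_ge0 => i _; exact: sqr_ge0.
have B0 : 0 <= B by apply: sumr_ge0 => i _; exact: sqr_ge0.
have : 0 <= \sum_i (B * f i - C * g i) ^+ 2.
  by apply: sumr_ge0 => i _; exact: sqr_ge0.
(* The expansion shows the sign of [A * B - C ^+ 2] unless [B = 0]; in that case every [g i]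
   vanishes. *)
have -> : \sum_i (B * f i - C * g i) ^+ 2 = B * (A * B - C ^+ 2).
  transitivity (\sum_i (B ^+ 2 * f i ^+ 2 - 2 * B * C * (f i * g i)
      + C ^+ 2 * g i ^+ 2)); first by apply: eq_bigr => i _; ring.
  by rewrite big_split/= sumrB -!mulr_sumr -/A -/B -/C; ring.
rewrite -sqrtrM// => H.
apply: (le_trans (ler_norm C)); rewrite -sqrtr_sqr ler_wsqrtr//.
have [B_eq0|Bpos] := eqVneq B 0; last by rewrite pmulr_rge0 ?lt0r ?Bpos// subr_ge0 in H.
have g0 i : g i = 0.
  apply/eqP; rewrite -sqrf_eq0; move/eqP: B_eq0.
  rewrite psumr_eq0 => [/allP/(_ i)|j _]; last exact: sqr_ge0.
  by rewrite mem_index_enum => /(_ isT).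
by rewrite B_eq0 mulr0 /C big1 ?expr0n// => i _; rewrite g0 mulr0.
Qed.

Lemma sqrt2_le (R : rcfType) : Num.sqrt 2 <= 3 / 2 :> R.
Proof.
rewrite -[leRHS]ger0_norm; last lra.
by rewrite -sqrtr_sqr ler_wsqrtr//; lra.
Qed.

Section Dot.
Context {R : realType} {m : nat}.
Implicit Types u v w : 'cV[R]_m.

Definition dot u v : R := \sum_(l < m) u l ord0 * v l ord0.

Lemma dotC u v : dot u v = dot v u.
Proof. by apply: eq_bigr => l _; rewrite mulrC. Qed.

Lemma dotDl u v w : dot (u + v) w = dot u w + dot v w.
Proof. by rewrite -big_split; apply: eq_bigr => l _; rewrite mxE mulrDl. Qed.

Lemma dotZl (k : R) u v : dot (k *: u) v = k * dot u v.
Proof. by rewrite /dot mulr_sumr; apply: eq_bigr => l _; rewrite mxE mulrA. Qed.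

Lemma dotNl u v : dot (- u) v = - dot u v.
Proof. by rewrite -scaleN1r dotZl mulN1r. Qed.

Lemma dotBl u v w : dot (u - v) w = dot u w - dot v w.
Proof. by rewrite dotDl dotNl. Qed.

Lemma dotDr u v w : dot w (u + v) = dot w u + dot w v.
Proof. by rewrite dotC dotDl !(dotC w). Qed.

Lemma dotZr (k : R) u v : dot v (k *: u) = k * dot v u.
Proof. by rewrite dotC dotZl dotC. Qed.

Lemma dotNr u v : dot v (- u) = - dot v u.
Proof. by rewrite dotC dotNl dotC. Qed.

Lemma dotBr u v w : dot w (u - v) = dot w u - dot w v.
Proof. by rewrite dotDr dotNr. Qed.

Lemma dot0l u : dot 0 u = 0.
Proof. by rewrite -(scale0r 0) dotZl mul0r. Qed.

Lemma dot0r u : dot u 0 = 0.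
Proof. by rewrite dotC dot0l. Qed.

Lemma dot_suml (I : finType) (F : I -> 'cV[R]_m) v :
  dot (\sum_i F i) v = \sum_i dot (F i) v.
Proof.
by elim/big_rec2: _ => [|i x y _ <-]; [exact: dot0l|rewrite dotDl].
Qed.

Lemma dot_sumr (I : finType) (F : I -> 'cV[R]_m) v :
  dot v (\sum_i F i) = \sum_i dot v (F i).
Proof. by rewrite dotC dot_suml; apply: eq_bigr => i _; rewrite dotC. Qed.

Lemma dotE u : dot u u = \sum_(l < m) u l ord0 ^+ 2.
Proof. by apply: eq_bigr => l _; rewrite expr2. Qed.

Lemma dot_ge0 u : 0 <= dot u u.
Proof. by rewrite dotE; apply: sumr_ge0 => l _; exact: sqr_ge0. Qed.

Lemma enormE u : enorm u = Num.sqrt (dot u u).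
Proof. by rewrite dotE. Qed.

Lemma enorm_ge0 u : 0 <= enorm u.
Proof. exact: sqrtr_ge0. Qed.

Lemma enorm_sqr u : enorm u ^+ 2 = dot u u.
Proof. by rewrite enormE sqr_sqrtr// dot_ge0. Qed.

Lemma dot_le u v : dot u v <= enorm u * enorm v.
Proof. exact: sum_cauchy_schwarz. Qed.

Lemma dot_geN u v : - (enorm u * enorm v) <= dot u v.
Proof.
rewrite lerNl -dotNl; apply: le_trans (dot_le _ _) _.
by rewrite !enormE dotNl dotNr opprK.
Qed.

Lemma enormN u : enorm (- u) = enorm u.
Proof. by rewrite !enormE dotNl dotNr opprK. Qed.

Lemma enorm0 : enorm (0 : 'cV[R]_m) = 0.
Proof. by rewrite enormE dot0l sqrtr0. Qed.

Lemma enormBC u v : enorm (u - v) = enorm (v - u).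
Proof. by rewrite -opprB enormN. Qed.

Lemma enormZ (k : R) u : enorm (k *: u) = `|k| * enorm u.
Proof. by rewrite !enormE dotZl dotZr mulrA -expr2 sqrtrM ?sqr_ge0// sqrtr_sqr. Qed.

Lemma enormD u v : enorm (u + v) <= enorm u + enorm v.
Proof.
rewrite -(@ler_pXn2r _ 2)// ?nnegrE ?addr_ge0 ?enorm_ge0//.
rewrite enorm_sqr dotDl !dotDr (dotC v u) sqrrD !enorm_sqr.
by have := dot_le u v; lra.
Qed.

Lemma enormB u v : enorm (u - v) <= enorm u + enorm v.
Proof. by have := enormD u (- v); rewrite enormN. Qed.

Lemma enorm_leB u v : `|enorm u - enorm v| <= enorm (u - v).
Proof.
have h (a b : 'cV[R]_m) : enorm a - enorm b <= enorm (a - b).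
  by rewrite lerBlDr; have := enormD (a - b) b; rewrite subrK.
by rewrite ler_norml h lerNl opprB enormBC h.
Qed.

Lemma enorm_sum (I : finType) (F : I -> 'cV[R]_m) :
  enorm (\sum_i F i) <= \sum_i enorm (F i).
Proof.
elim/big_rec2: _ => [|i x y _ h]; first by rewrite enorm0.
by rewrite (le_trans (enormD _ _))// lerD2l.
Qed.

Lemma enormB_sqr u v : enorm (u - v) ^+ 2 <= 2 * (enorm u ^+ 2 + enorm v ^+ 2).
Proof.
have := dot_ge0 (u + v).
rewrite !enorm_sqr !dotDl !dotDr !dotNl !dotNr (dotC v u); lra.
Qed.

End Dot.

(** * Deviations from the mean *)

Section Perp.
Context {R : realType} {N : nat}.
Hypothesis N0 : (0 < N)%N.
Let NR0 : 0 < N%:R :> R. Proof. by rewrite ltr0n. Qed.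
Let NRn0 : N%:R != 0 :> R. Proof. by rewrite gt_eqF. Qed.

Section Fix.
Context {m : nat}.
Implicit Types z : 'I_N -> 'cV[R]_m.

Lemma sum_perp z : \sum_i perp z i = 0.
Proof.
rewrite sumrB sumr_const card_ord /mean -scaler_nat scalerA divff// scale1r.
exact: subrr.
Qed.

Lemma perp_sub z i j : perp z i - perp z j = z i - z j.
Proof. by rewrite /perp opprB addrA subrK. Qed.

Lemma sum_dot_perp_cst z (c : 'cV[R]_m) : \sum_i dot (perp z i) c = 0.
Proof. by rewrite -dot_suml sum_perp dot0l. Qed.

Lemma sum_dot_perp z z' :
  \sum_i dot (perp z i) (perp z' i) = \sum_i dot (perp z i) (z' i).
Proof.
under eq_bigr do rewrite dotBr.
by rewrite sumrB sum_dot_perp_cst subr0.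
Qed.

Lemma perpB z z' i : perp (fun i => z i - z' i) i = perp z i - perp z' i.
Proof.
by rewrite /perp /mean sumrB scalerBr !opprB addrACA [in RHS]addrACA [- z' i - _]addrC.
Qed.

(** Pythagoras: summed over the agents, the deviations are orthogonal to the constant family given
    by the mean. *)
Lemma sum_perp_le z : \sum_i enorm (perp z i) ^+ 2 <= \sum_i enorm (z i) ^+ 2.
Proof.
under [leLHS]eq_bigr do rewrite enorm_sqr.
have -> : \sum_i enorm (z i) ^+ 2 =
   \sum_i (dot (perp z i) (perp z i) + 2 * dot (perp z i) (mean z)
      + dot (mean z) (mean z)).
  apply: eq_bigr => i _; rewrite enorm_sqr !dotBl !dotBr (dotC (mean z) (z i)).
  ring.
rewrite !big_split/= -mulr_sumr sum_dot_perp_cst mulr0 addr0 lerDl.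
by apply: sumr_ge0 => i _; exact: dot_ge0.
Qed.

(** Once each difference is written with deviations, the cross terms cancel because the deviations
    sum to zero. *)
Lemma sum_dist_sqr z : \sum_i \sum_j enorm (z i - z j) ^+ 2 =
  2 * N%:R * \sum_i enorm (perp z i) ^+ 2.
Proof.
set S := \sum_i enorm (perp z i) ^+ 2.
transitivity (\sum_(i < N) \sum_(j < N) (enorm (perp z i) ^+ 2
    + enorm (perp z j) ^+ 2 - 2 * dot (perp z i) (perp z j))).
  apply: eq_bigr => i _; apply: eq_bigr => j _.
  rewrite -perp_sub !enorm_sqr; move: (perp z i) (perp z j) => p q.
  by rewrite dotBl !dotBr (dotC q p); ring.
transitivity (\sum_(i < N) (N%:R * enorm (perp z i) ^+ 2 + S)).
  apply: eq_bigr => i _; rewrite sumrB big_split/= sumr_const card_ord.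
  by rewrite -mulr_sumr -dot_sumr sum_perp dot0r mulr0 subr0 mulr_natl.
rewrite big_split/= -mulr_sumr sumr_const card_ord -/S -mulr_natl; ring.
Qed.

Lemma spreadE z : spread z = N%:R^-1 * \sum_i enorm (perp z i) ^+ 2.
Proof. by rewrite /spread sum_dist_sqr; field. Qed.

Lemma spread_ge0 z : 0 <= spread z.
Proof.
by rewrite spreadE mulr_ge0 ?invr_ge0 ?ler0n// sumr_ge0// => i _; exact: sqr_ge0.
Qed.

Lemma sum_perpE z : \sum_i enorm (perp z i) ^+ 2 = N%:R * spread z.
Proof. by rewrite spreadE mulrA divff// mul1r. Qed.

Lemma enorm_perp_le z i : enorm (perp z i) <= Num.sqrt (N%:R * spread z).
Proof.
rewrite -(ger0_norm (enorm_ge0 _)) -sqrtr_sqr ler_wsqrtr// -sum_perpE.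
by rewrite (bigD1 i)//= lerDl sumr_ge0// => j _; exact: sqr_ge0.
Qed.

(** For distinct agents both squared deviations occur in N times the spread, hence the constant
    [Num.sqrt 2] where the triangle inequality would give 2. *)
Lemma dist_le_spread z i j : enorm (z i - z j) <=
  Num.sqrt 2 * (Num.sqrt N%:R * Num.sqrt (spread z)).
Proof.
rewrite -(sqrtrM _ (ler0n _ _)) -sqrtrM//.
rewrite -(ger0_norm (enorm_ge0 _)) -sqrtr_sqr ler_wsqrtr//.
have [->|ij] := eqVneq i j.
  by rewrite subrr enorm0 expr0n mulr_ge0// mulr_ge0 ?ler0n ?spread_ge0.
rewrite -perp_sub (le_trans (enormB_sqr _ _))// ler_pM2l// -sum_perpE.
rewrite (bigD1 i)//= (bigD1 j) 1?eq_sym//= addrA lerDl.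
by apply: sumr_ge0 => l _; exact: sqr_ge0.
Qed.

Lemma spread_le_max z (b : R) : (forall i, enorm (perp z i) <= b) ->
  spread z <= b ^+ 2.
Proof.
move=> h; rewrite spreadE ler_pdivrMl//.
rewrite -[X in X%:R]card_ord mulr_natl -sumr_const; apply: ler_sum => i _.
by rewrite lerXn2r ?nnegrE ?(le_trans _ (h i)) ?enorm_ge0.
Qed.

End Fix.

Lemma perp_mulmx {k d : nat} (M : 'M[R]_(k, d)) (z : 'I_N -> 'cV[R]_d) i :
  perp (fun i => M *m z i) i = M *m perp z i.
Proof. by rewrite /perp /mean mulmxBr -scalemxAr mulmx_sumr. Qed.

End Perp.

(** * Decay over one sampling interval *)

Definition vderiv_on (R : realType) (m : nat) (s e : R)
    (p dp : R -> 'cV[R]_m) : Prop :=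
  forall l, deriv_on s e (fun t => p t l ord0) (fun t => dp t l ord0).

Section VDerivOn.
Context {R : realType} {m : nat}.
Implicit Types (s e : R) (p q dp dq : R -> 'cV[R]_m).

Lemma is_derive_coord p (dp : 'cV[R]_m) t l : is_derive t (1 : R) p dp ->
  is_derive t (1 : R) (fun s => p s l ord0) (dp l ord0).
Proof.
move=> [hp <-].
rewrite derive_mx// mxE; apply: derivableP.
exact: (derivable_mxP _ _ _).1.
Qed.

Lemma vderiv_onP s e p dp : 0 <= s -> {within `[0, +oo[, continuous p} ->
  (forall t, s < t < e -> is_derive t (1 : R) p (dp t)) -> vderiv_on s e p dp.
Proof.
move=> s0 cp hp l; split=> [|t st]; last exact/is_derive_coord/hp.
have cp' : {within `[s, e], continuous p}.
  apply: continuous_subspaceW cp => x /=; rewrite !in_itv/= andbT => /andP[sx _].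
  exact: le_trans sx.
have cl : continuous (fun z : 'cV[R]_m => z l ord0) by exact: coord_continuous.
by move=> x; exact: (continuous_comp (cp' x) (cl _)).
Qed.

Lemma vderiv_onW s e s' e' p dp :
  s <= s' -> e' <= e -> vderiv_on s e p dp -> vderiv_on s' e' p dp.
Proof. by move=> ss ee hp l; apply: deriv_onW (hp l). Qed.

Lemma vderiv_on_cst s e (c : 'cV[R]_m) : vderiv_on s e (fun=> c) (fun=> 0).
Proof.
by move=> l; apply: deriv_on_eq (deriv_on_cst s e (c l ord0)) => // t _; rewrite mxE.
Qed.

Lemma vderiv_onB s e p q dp dq : vderiv_on s e p dp -> vderiv_on s e q dq ->
  vderiv_on s e (fun t => p t - q t) (fun t => dp t - dq t).
Proof.
move=> hp hq l.
by apply: deriv_on_eq (deriv_onB (hp l) (hq l)) => t; rewrite !mxE.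
Qed.

Lemma vderiv_onZ s e (k : R) p dp : vderiv_on s e p dp ->
  vderiv_on s e (fun t => k *: p t) (fun t => k *: dp t).
Proof. by move=> hp l; apply: deriv_on_eq (deriv_onZ k (hp l)) => t; rewrite !mxE. Qed.

Lemma vderiv_on_sum s e (I : finType) (f df : I -> R -> 'cV[R]_m) :
  (forall i, vderiv_on s e (f i) (df i)) ->
  vderiv_on s e (fun t => \sum_i f i t) (fun t => \sum_i df i t).
Proof.
move=> hf l; have := deriv_on_sum (fun i => hf i l).
by apply: deriv_on_eq => t; rewrite summxE.
Qed.

Lemma deriv_on_dot s e p q dp dq : vderiv_on s e p dp -> vderiv_on s e q dq ->
  deriv_on s e (fun t => dot (p t) (q t))
    (fun t => dot (dp t) (q t) + dot (p t) (dq t)).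
Proof.
move=> hp hq; have := deriv_on_sum (fun l => deriv_onM (hp l) (hq l)).
by apply: deriv_on_eq => t // _; rewrite big_split.
Qed.

End VDerivOn.

Lemma vderiv_on_mulmx (R : realType) (k d : nat) (M : 'M[R]_(k, d)) (s e : R)
    (p dp : R -> 'cV[R]_d) : vderiv_on s e p dp ->
  vderiv_on s e (fun t => M *m p t) (fun t => M *m dp t).
Proof.
move=> hp l; have := deriv_on_sum (fun j => deriv_onZ (M l j) (hp j)).
by apply: deriv_on_eq => t; rewrite mxE.
Qed.

Section Family.
Context {R : realType} {N m : nat}.
Hypothesis N0 : (0 < N)%N.
Let NR0 : 0 < N%:R :> R. Proof. by rewrite ltr0n. Qed.
Let NRn0 : N%:R != 0 :> R. Proof. by rewrite gt_eqF. Qed.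
Implicit Types (p q dp dq : R -> 'I_N -> 'cV[R]_m) (z : 'I_N -> 'cV[R]_m).

Lemma vderiv_on_perp (s e : R) p dp i : (forall i, vderiv_on s e (p ^~ i) (dp ^~ i)) ->
  vderiv_on s e (fun t => perp (p t) i) (fun t => perp (dp t) i).
Proof.
move=> hp; apply: vderiv_onB; first exact: hp.
by apply: vderiv_onZ; exact: vderiv_on_sum.
Qed.

Lemma deriv_on_sumsq (s e : R) p dp : (forall i, vderiv_on s e (p ^~ i) (dp ^~ i)) ->
  deriv_on s e (fun t => \sum_i enorm (p t i) ^+ 2)
    (fun t => 2 * \sum_i dot (p t i) (dp t i)).
Proof.
move=> hp; have := deriv_on_sum (fun i => deriv_on_dot (hp i) (hp i)).
apply: deriv_on_eq => t; first by apply: eq_bigr => i _; rewrite enorm_sqr.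
move=> _; rewrite mulr_sumr; apply: eq_bigr => i _.
by rewrite (dotC (dp t i)) -mulr2n mulr_natl.
Qed.

(** The derivative of the mean drops out, because the deviations sum to zero. *)
Lemma deriv_on_spread (s e : R) p dp : (forall i, vderiv_on s e (p ^~ i) (dp ^~ i)) ->
  deriv_on s e (fun t => spread (p t))
    (fun t => 2 / N%:R * \sum_i dot (perp (p t) i) (dp t i)).
Proof.
move=> hp; have hpp i := vderiv_on_perp i hp.
have := deriv_onZ N%:R^-1 (deriv_on_sumsq hpp).
apply: deriv_on_eq => t; first by rewrite spreadE.
by move=> _; rewrite sum_dot_perp// mulrA [_^-1 * _]mulrC.
Qed.

(** Cauchy-Schwarz, first in space and then over the agents, bounds half the derivative of the
    spread of [p] by the product of the square roots of the spreads of [p] and [q]. *)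
Lemma sqrt_spread_le (s e S0 : R) p q : s <= e -> 0 <= S0 ->
  (forall i, vderiv_on s e (p ^~ i) (q ^~ i)) ->
  (forall t, s < t < e -> Num.sqrt (spread (q t)) <= S0) ->
  Num.sqrt (spread (p e)) <= Num.sqrt (spread (p s)) + S0 * (e - s).
Proof.
move=> se S00 hp hS; apply: (deriv_on_sqrt_le (f := fun t => spread (p t)) se S00)
    (deriv_on_spread hp) _ => [t|t st]; first exact: spread_ge0.
rewrite -sum_dot_perp//.
have h : \sum_i dot (perp (p t) i) (perp (q t) i) <=
    N%:R * (Num.sqrt (spread (p t)) * Num.sqrt (spread (q t))).
  apply: le_trans (ler_sum _ (fun i _ => dot_le _ _)) _.
  apply: le_trans (sum_cauchy_schwarz _ _) _.
  rewrite !sum_perpE// !sqrtrM ?ler0n// mulrACA -expr2 sqr_sqrtr ?ler0n//.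
apply: le_trans (ler_wpM2l _ h) _; first by rewrite divr_ge0.
rewrite -!mulrA mulKf// ler_pM2l// mulrC ler_wpM2r ?sqrtr_ge0//.
exact: hS.
Qed.

(** Symmetrization: adding the double sum to itself with i and j exchanged turns each term into
    [- c i j * enorm (z i - z j) ^+ 2]. *)
Lemma dissipation z (c : 'I_N -> 'I_N -> R) :
  (forall i j, c i j = c j i) -> (forall i j, 0 <= c i j) ->
  \sum_i dot (z i) (N%:R^-1 *: \sum_j c i j *: (z j - z i)) <= 0.
Proof.
move=> cC c0.
under eq_bigr do rewrite dotZr dot_sumr.
rewrite -mulr_sumr pmulr_rle0 ?invr_gt0//.
set A := (X in X <= 0).
have E1 : A = \sum_i \sum_j c i j * dot (z i) (z j - z i).
  by apply: eq_bigr => i _; apply: eq_bigr => j _; rewrite dotZr.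
have E2 : A = \sum_i \sum_j c i j * dot (z j) (z i - z j).
  rewrite E1 exchange_big; apply: eq_bigr => i _; apply: eq_bigr => j _.
  by rewrite cC.
suff : A + A <= 0 by lra.
rewrite {1}E1 E2 -big_split; apply: sumr_le0 => i _.
rewrite -big_split; apply: sumr_le0 => j _ /=.
rewrite -mulrDr mulr_ge0_le0//.
have := dot_ge0 (z i - z j).
rewrite !dotBr !dotBl (dotC (z j) (z i)); lra.
Qed.

Section Alignment.
Variable a : R -> R.
Hypothesis a_pos : forall r, 0 <= r -> 0 < a r.
Hypothesis a_mono : forall r s, 0 <= r -> r <= s -> a s <= a r.

Lemma alignment_dissipation (z w : 'I_N -> 'cV[R]_m) :
  \sum_i dot (perp w i) (alignment a z w i) <= 0.
Proof.
have := @dissipation (perp w) (fun i j => a (enorm (z i - z j))) _ _.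
rewrite /alignment; under eq_bigr do under eq_bigr do rewrite perp_sub.
apply=> i j; first by rewrite enormBC.
by rewrite ltW// a_pos// enorm_ge0.
Qed.

(** The exchange terms are antisymmetric in the two agents, so only the control can move the mean
    velocity. *)
Lemma sum_alignment (z w : 'I_N -> 'cV[R]_m) : \sum_i alignment a z w i = 0.
Proof.
rewrite /alignment -scaler_sumr.
under eq_bigr do under eq_bigr do rewrite scalerBr.
under eq_bigr do rewrite sumrB.
rewrite sumrB [X in _ - X]exchange_big/=.
under [X in _ - X]eq_bigr do under eq_bigr do rewrite enormBC.
by rewrite subrr scaler0.
Qed.

Lemma enorm_alignment_le (z w : 'I_N -> 'cV[R]_m) i :
  enorm (alignment a z w i) <=
    a 0 * (Num.sqrt 2 * (Num.sqrt N%:R * Num.sqrt (spread w))).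
Proof.
rewrite /alignment enormZ ger0_norm ?invr_ge0 ?ler0n// ler_pdivrMl//.
apply: le_trans (enorm_sum _) _.
have -> (x : R) : N%:R * x = \sum_(j < N) x by rewrite sumr_const card_ord mulr_natl.
apply: ler_sum => j _.
have ar := a_pos (enorm_ge0 (z i - z j)).
rewrite enormZ ger0_norm ?(ltW ar)// ler_pM ?enorm_ge0 ?(ltW ar)//.
  by rewrite a_mono// enorm_ge0.
exact: dist_le_spread.
Qed.

(** * A control frozen on one agent *)

Section Step.
Variables (s e tau theta b rho : R) (p q : R -> 'I_N -> 'cV[R]_m) (iota : 'I_N).
Variable U : 'I_N -> 'cV[R]_m.
Hypothesis theta0 : 0 <= theta.
Hypothesis se : s <= e.
Hypothesis etau : e - s <= tau.
Hypothesis hq : forall i,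
  vderiv_on s e (q ^~ i) (fun t => alignment a (p t) (q t) i + U i).
Let xi := perp (q s) iota.
Let S0 := Num.sqrt (spread (q s)).
Hypothesis xi0 : 0 < enorm xi.
Hypothesis hU : forall i, U i = if i == iota then - (theta / enorm xi) *: xi else 0.
(** [b] dominates the loss of the controlled deviation in the direction [xi] during one interval: at
    most [tau] times the alignment force, with 3/2 for the square root of 2, plus the control
    strength. [rho] measures what is left relative to [S0]. *)
Hypothesis hb : tau * (a 0 * (3 / 2 * (Num.sqrt N%:R * S0 + theta * tau)) + theta) <= b.
Hypothesis hrho : rho * S0 <= enorm xi - b.

Let tau0 : 0 <= tau. Proof. by apply: le_trans etau; rewrite subr_ge0. Qed.
Let a0 : 0 <= a 0. Proof. exact/ltW/a_pos. Qed.

Let dspread_le t :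
  2 / N%:R * \sum_i dot (perp (q t) i) (alignment a (p t) (q t) i + U i) <=
  2 / N%:R * dot (perp (q t) iota) (U iota).
Proof.
rewrite ler_wpM2l ?divr_ge0 ?ler0n//.
under eq_bigr do rewrite dotDr.
rewrite big_split/= [X in _ + X](bigD1 iota)//= [X in _ + (_ + X)]big1 ?addr0.
  by rewrite gerDr alignment_dissipation.
by move=> i iio; rewrite hU (negPf iio) dot0r.
Qed.

Let enormU : enorm (U iota) = theta.
Proof.
rewrite hU eqxx enormZ normrN ger0_norm ?divr_ge0 ?enorm_ge0//.
by rewrite divfK// gt_eqF.
Qed.

(** A crude bound that ignores the direction of the control: alignment cannot increase the spread
    and the control has norm [theta]. It is what bounds the alignment force in the proof of
    decay. *)
Lemma step_growth t : s <= t <= e ->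
  Num.sqrt (spread (q t)) <= S0 + theta / Num.sqrt N%:R * (t - s).
Proof.
move=> /andP[st te].
have hq' i := vderiv_onW (lexx s) te (hq i).
apply: (deriv_on_sqrt_le (f := fun t => spread (q t)) st _ _ (deriv_on_spread hq')).
- by rewrite divr_ge0 ?sqrtr_ge0.
- by move=> r; exact: spread_ge0.
move=> r _; apply: le_trans (dspread_le r) _.
have sN : 0 < Num.sqrt N%:R :> R by rewrite sqrtr_gt0.
have h := le_trans (dot_le (perp (q r) iota) (U iota))
  (ler_wpM2r (enorm_ge0 _) (enorm_perp_le N0 (q r) iota)).
apply: le_trans (ler_wpM2l _ h) _; first by rewrite divr_ge0.
rewrite enormU sqrtrM ?ler0n// -{1}(sqr_sqrtr (ler0n R N)).
rewrite le_eqVlt; apply/orP; left; apply/eqP.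
by field; rewrite gt_eqF.
Qed.

Lemma step_decay t1 t2 : s <= t1 -> t1 <= t2 -> t2 <= e ->
  spread (q t2) <= spread (q t1) - 2 * theta * rho / N%:R * S0 * (t2 - t1).
Proof.
move=> st1 t12 t2e.
(* The controlled agent cannot turn away from the frozen direction [xi] by more
   than [b] within one sampling interval, so the control keeps pushing it towards
   the mean. *)
have hg t : s <= t <= e -> enorm xi * (enorm xi - b) <= dot (perp (q t) iota) xi.
  move=> /andP[st te].
  have hq' i := vderiv_onW (lexx s) te (hq i).
  (* The negated inner product is differentiated, so that an upper bound on its derivative yields a
     lower bound on the inner product. *)
  have hd := deriv_onZ (-1)
    (deriv_on_dot (vderiv_on_perp iota hq') (vderiv_on_cst s t xi)).
  pose L := (a 0 * (3 / 2 * (Num.sqrt N%:R * S0 + theta * tau)) + theta).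
  have := deriv_on_le (K := L * enorm xi) st hd.
  have /[swap]/[apply] : forall r, s < r < t ->
     -1 * (dot (perp (fun i => alignment a (p r) (q r) i + U i) iota) xi
           + dot (perp (q r) iota) 0) <= L * enorm xi.
    move=> r /andP[sr rt].
    rewrite dot0r addr0 /perp /mean big_split/= sum_alignment add0r.
    have -> : \sum_i U i = U iota.
      rewrite (bigD1 iota)//= big1 ?addr0// => i iio.
      by rewrite hU (negPf iio).
    rewrite mulN1r lerNl dotBl dotDl (dotZl _ (U iota)).
    have -> : dot (U iota) xi = - theta * enorm xi.
      rewrite hU eqxx dotZl -enorm_sqr expr2 mulrA mulNr divfK//.
      by rewrite gt_eqF.
    have h1 := dot_geN (alignment a (p r) (q r) iota) xi.
    have h2 : enorm (alignment a (p r) (q r) iota) <=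
        a 0 * (3 / 2 * (Num.sqrt N%:R * S0 + theta * tau)).
      apply: le_trans (enorm_alignment_le _ _ _) _.
      rewrite ler_wpM2l//; apply: ler_pM; rewrite ?sqrt2_le ?mulr_ge0 ?sqrtr_ge0//.
      have hgr : s <= r <= e by rewrite ltW//= (le_trans (ltW rt)).
      apply: le_trans (ler_wpM2l (sqrtr_ge0 _) (step_growth hgr)) _.
      have -> : Num.sqrt N%:R * (S0 + theta / Num.sqrt N%:R * (r - s)) =
          Num.sqrt N%:R * S0 + theta * (r - s).
        by field; rewrite gt_eqF ?sqrtr_gt0.
      rewrite lerD2l; apply: ler_wpM2l => //.
      by rewrite (le_trans _ etau)// lerD2r (le_trans (ltW rt)).
    have h3 := ler_wpM2r (enorm_ge0 xi) h2.
    (* The shift of the mean caused by the control acts in the favourable direction and is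
       dropped. *)
    have N1 : N%:R^-1 * (- theta * enorm xi) <= 0.
      by rewrite pmulr_rle0 ?invr_gt0// mulNr oppr_le0 mulr_ge0// enorm_ge0.
    rewrite /L mulrDl; lra.
  rewrite -/xi -enorm_sqr !mulN1r => H.
  have : L * enorm xi * (t - s) <= b * enorm xi.
    rewrite mulrAC ler_wpM2r ?enorm_ge0// (le_trans _ hb)// mulrC.
    apply: ler_wpM2r; last by rewrite (le_trans _ etau)// lerD2r.
    by rewrite addr_ge0// !mulr_ge0// addr_ge0 ?mulr_ge0 ?sqrtr_ge0.
  move: H; rewrite expr2 mulrBr [b * _]mulrC; lra.
have hq' i := vderiv_onW st1 t2e (hq i).
have := deriv_on_le (K := - (2 * theta * rho / N%:R * S0)) t12 (deriv_on_spread hq').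
rewrite mulNr; apply=> t /andP[tt1 tt2].
apply: le_trans (dspread_le t) _.
have ht : s <= t <= e by rewrite (le_trans st1 (ltW tt1)) (le_trans (ltW tt2)).
rewrite hU eqxx dotZr.
have h1 : theta * (rho * S0) <= theta / enorm xi * dot (perp (q t) iota) xi.
  rewrite -mulrA ler_wpM2l// ler_pdivlMl// (le_trans _ (hg t ht))//.
  by rewrite ler_pM2l.
have : 2 / N%:R * (theta * (rho * S0)) <=
   2 / N%:R * (theta / enorm xi * dot (perp (q t) iota) xi).
  by rewrite ler_wpM2l ?divr_ge0.
by rewrite mulNr; lra.
Qed.

Lemma step_bounds t : 0 < theta -> 0 < rho ->
  (forall i, vderiv_on s e (p ^~ i) (q ^~ i)) -> s <= t <= e ->
  [/\ spread (q e) <= spread (q t), spread (q t) <= spread (q s),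
      Num.sqrt (spread (q t)) <= S0 - theta * rho / N%:R * (t - s),
      Num.sqrt (spread (p t)) <= Num.sqrt (spread (p s)) + S0 * (t - s)
    & Num.sqrt (spread (p t)) + N%:R / (2 * theta * rho) * spread (q t) <=
      Num.sqrt (spread (p s)) + N%:R / (2 * theta * rho) * spread (q s)].
Proof.
move=> th0 r0 hp /andP[st te].
have Spos : 0 < S0.
  have := lt_le_trans xi0 (enorm_perp_le N0 (q s) iota).
  by rewrite !sqrtr_gt0 pmulr_rgt0.
have S00 := ltW Spos.
have c0 t1 t2 : t1 <= t2 -> 0 <= 2 * theta * rho / N%:R * S0 * (t2 - t1).
  move=> t12; rewrite !mulr_ge0 ?invr_ge0 ?(ltW th0) ?(ltW r0) ?(ltW NR0)//.
  by rewrite subr_ge0.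
have dle t1 t2 : s <= t1 -> t1 <= t2 -> t2 <= e -> spread (q t2) <= spread (q t1).
  move=> st1 t12 t2e; apply: le_trans (step_decay st1 t12 t2e) _.
  by rewrite lerBlDr lerDl c0.
have hd := step_decay (lexx s) st te.
have hX : Num.sqrt (spread (p t)) <= Num.sqrt (spread (p s)) + S0 * (t - s).
  have hp' i := vderiv_onW (lexx s) te (hp i).
  apply: (sqrt_spread_le st S00 hp') => r /andP[sr rt].
  by rewrite ler_wsqrtr// dle// ?lexx ?(ltW sr)// (le_trans (ltW rt)).
split=> //; [exact: dle|exact: dle| |].
  set D := theta * rho / N%:R * (t - s).
  have D0 : 0 <= D.
    by rewrite !mulr_ge0 ?invr_ge0 ?(ltW th0) ?(ltW r0) ?(ltW NR0)// subr_ge0.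
  have h : spread (q t) <= S0 ^+ 2 - 2 * D * S0.
    rewrite sqr_sqrtr ?spread_ge0//; apply: le_trans hd _.
    by rewrite /D; lra.
  have q0 := spread_ge0 N0 (q t).
  (* If [D] exceeded [S0], then [h] would make the spread negative. Adding [D ^+ 2] to the right
     side of [h] then completes the square [(S0 - D) ^+ 2]. *)
  have SD : D <= S0.
    rewrite leNgt; apply/negP => SD.
    have := ler_wpM2r S00 (ltW SD); have := mulr_gt0 Spos Spos.
    by move: h; rewrite expr2; lra.
  apply: (@le_trans _ _ (Num.sqrt ((S0 - D) ^+ 2))); last first.
    by rewrite sqrtr_sqr ger0_norm// subr_ge0.
  by rewrite ler_wsqrtr//; nra.
(* [Num.sqrt (spread (p t))] grows at rate at most [S0], while [spread (q t)]
   decreases at a rate proportional to [S0]: hence their combination decreases. *)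
have h : N%:R / (2 * theta * rho) * spread (q t) <=
   N%:R / (2 * theta * rho) * spread (q s) - S0 * (t - s).
  have c1 : 0 < N%:R / (2 * theta * rho) by rewrite divr_gt0// !mulr_gt0.
  have := ler_wpM2l (ltW c1) hd; rewrite mulrBr.
  have -> // : N%:R / (2 * theta * rho) * (2 * theta * rho / N%:R * S0 * (t - s)) =
      S0 * (t - s).
  by field; rewrite !gt_eqF.
lra.
Qed.

End Step.
End Alignment.
End Family.

(** * Growth of the projection error *)

(* [D * t * expR ((lambda + kappa) * t)] is a supersolution, and it bounds the
   delayed value [E s] because it is increasing. *)
Lemma delayed_gronwall (R : realType) (s e lambda kappa D : R) (E dE : R -> R) :
  0 <= s -> s <= e -> 0 <= lambda -> 0 <= kappa -> 0 <= D ->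
  deriv_on s e E dE ->
  (forall t, s < t < e -> dE t <= lambda * E t + kappa * E s + D) ->
  E s <= D * s * expR ((lambda + kappa) * s) ->
  E e <= D * e * expR ((lambda + kappa) * e).
Proof.
move=> s0 se l0 k0 D0 hE hdE hs.
set mu := lambda + kappa in hs *.
have mu0 : 0 <= mu by rewrite addr_ge0.
have hB := deriv_onM (deriv_onZ D (deriv_on_id s e)) (deriv_on_expZ s e mu).
have := gronwall_le0 (L := lambda) se (deriv_onB hE hB).
rewrite /= !subr_le0; apply=> // t /andP[st te].
have hd := hdE t; rewrite st te in hd; have {}hd := hd isT.
have e1 : 1 <= expR (mu * t).
  by rewrite -expR0 ler_expR mulr_ge0// (le_trans s0 (ltW st)).
have h1 : D <= D * expR (mu * t) by rewrite ler_peMr.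
have h2 : kappa * E s <= kappa * (D * t * expR (mu * t)).
  rewrite ler_wpM2l// (le_trans hs)// ler_pM ?expR_ge0 ?mulr_ge0//.
    by rewrite ler_wpM2l// ltW.
  by rewrite ler_expR ler_wpM2l// ltW.
have -> : D * t * (expR (mu * t) * mu) =
   lambda * (D * t * expR (mu * t)) + kappa * (D * t * expR (mu * t)).
  by rewrite /mu; ring.
rewrite mulr1 mulrBr; lra.
Qed.

Section JL.
Context {R : realType} {k d : nat}.
Variable M : 'M[R]_(k, d).

(** In the first alternative the gap is at most [eps * Z1]; in the second both norms lie between 0
    and [eps * Z0]. *)
Lemma weak_JL_gap (eps Z0 Z1 : R) (z : 'cV[R]_d) : 0 <= eps -> 0 <= Z0 ->
  enorm z <= Z1 -> weak_JL M eps (eps * Z0) z ->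
  `|enorm z - enorm (M *m z)| <= eps * (Z1 + Z0).
Proof.
move=> eps0 Z00 zZ; have z0 := enorm_ge0 z; have Mz0 := enorm_ge0 (M *m z).
have h1 := ler_wpM2l eps0 zZ; have h2 := mulr_ge0 eps0 Z00.
have h3 := mulr_ge0 eps0 (le_trans z0 zZ).
case=> [[l u]|[l u]]; rewrite ler_norml mulrDr.
  by move: l u; rewrite mulrBl mulrDl !mul1r => l u; apply/andP; split; lra.
by apply/andP; split; lra.
Qed.

(** The strong property compares the length of [M *m v] with that of [v], at cost [theta * eps].
    Replacing the length and then the direction of [M *m v] by those of [w] costs [theta / enorm w]
    times the error each time, and [enorm w] is at least [2 * Delta]. *)
Lemma control_gap (eps theta Delta : R) (v : 'cV[R]_d) (w : 'cV[R]_k) :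
  0 <= theta -> 0 < Delta -> 0 < enorm v -> 2 * Delta <= enorm w ->
  strong_JL M eps v ->
  enorm (M *m (- (theta / enorm v) *: v) - - (theta / enorm w) *: w) <=
    theta * eps + theta / Delta * enorm (M *m v - w).
Proof.
move=> th0 D0 v0 wD [l u].
have w0 : 0 < enorm w by apply: lt_le_trans wD; rewrite mulr_gt0.
have -> : M *m (- (theta / enorm v) *: v) - - (theta / enorm w) *: w =
   (theta * ((enorm w)^-1 - (enorm v)^-1)) *: (M *m v)
   - (theta / enorm w) *: (M *m v - w).
  rewrite -scalemxAr mulrBr scalerBl scalerBr !scaleNr opprK opprB.
  by rewrite [RHS]addrC addrA subrK addrC.
apply: le_trans (enormB _ _) _.
rewrite !enormZ !normrM !(ger0_norm th0).
rewrite [`|(enorm w)^-1|]ger0_norm ?invr_ge0 ?(ltW w0)//.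
have h1 : `|(enorm w)^-1 - (enorm v)^-1| * enorm (M *m v) <=
    eps + (enorm w)^-1 * enorm (M *m v - w).
  rewrite -{1}[enorm (M *m v)]ger0_norm ?enorm_ge0// -normrM.
  have -> : ((enorm w)^-1 - (enorm v)^-1) * enorm (M *m v) =
     (enorm w)^-1 * (enorm (M *m v) - enorm w) + (1 - enorm (M *m v) / enorm v).
    by field; rewrite !gt_eqF.
  apply: le_trans (ler_normD _ _) _; rewrite addrC lerD//.
    rewrite ler_norml; apply/andP; split.
      by rewrite lerBrDl lerBlDr ler_pdivrMr// mulrC mulrC; lra.
    by rewrite lerBlDr -lerBlDl ler_pdivlMr//.
  rewrite normrM ger0_norm ?invr_ge0 ?(ltW w0)// ler_wpM2l ?invr_ge0 ?(ltW w0)//.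
  exact: enorm_leB.
have h2 : 2 * (enorm w)^-1 <= Delta^-1.
  by rewrite -ler_pdivlMl// -invfM lef_pV2 ?posrE ?mulr_gt0.
have := ler_wpM2l th0 h1.
have h3 : theta * (2 * (enorm w)^-1 * enorm (M *m v - w)) <=
          theta * (Delta^-1 * enorm (M *m v - w)).
  by rewrite ler_wpM2l// ler_wpM2r ?enorm_ge0.
move: h3; rewrite -!mulrA; lra.
Qed.

End JL.

Section ErrorStep.
Context {R : realType} {N k d : nat}.
Hypothesis N0 : (0 < N)%N.
Let NR0 : 0 < N%:R :> R. Proof. by rewrite ltr0n. Qed.
Let NRn0 : N%:R != 0 :> R. Proof. by rewrite gt_eqF. Qed.
Variables (a : R -> R) (La : R).
Hypothesis a_pos : forall r, 0 <= r -> 0 < a r.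
Hypothesis La0 : 0 <= La.
Hypothesis a_lip : forall r s, 0 <= r -> 0 <= s -> `|a r - a s| <= La * `|r - s|.
Variable M : 'M[R]_(k, d).

(** The Lipschitz bound on the kernel involves the distortion [eta] of distances and the position
    errors [g]. Young's inequality with weight [kappa] isolates the [eta] part as a source term. *)
Lemma alignment_error (x v : 'I_N -> 'cV[R]_d) (y w : 'I_N -> 'cV[R]_k)
    (kappa om eta : R) :
  let f i := M *m v i - w i in let g i := M *m x i - y i in
  0 < kappa -> 0 <= om -> 0 <= eta ->
  (forall i j, enorm (w j - w i) <= om) ->
  (forall i j, `|enorm (x i - x j) - enorm (M *m (x i - x j))| <= eta) ->
  2 * \sum_i dot (f i) (M *m alignment a x v i - alignment a y w i) <=
    3 / 2 * (La * om) * (\sum_i enorm (f i) ^+ 2 + \sum_i enorm (g i) ^+ 2)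
    + kappa * \sum_i enorm (f i) ^+ 2 + N%:R * (La * om * eta) ^+ 2 / kappa.
Proof.
move=> f g k0 om0 eta0 hw hx.
pose A i j := a (enorm (x i - x j)); pose B i j := a (enorm (y i - y j)).
(* The part of the difference that is linear in [f] is dissipative, so the bound
   does not involve [a 0]. *)
have -> : \sum_i dot (f i) (M *m alignment a x v i - alignment a y w i) =
    \sum_i dot (f i) (N%:R^-1 *: \sum_j A i j *: (f j - f i)) +
    \sum_i dot (f i) (N%:R^-1 *: \sum_j (A i j - B i j) *: (w j - w i)).
  rewrite -big_split; apply: eq_bigr => i _ /=; rewrite -dotDr; congr dot.
  rewrite -scalemxAr -scalerBr -scalerDr; congr (_ *: _).
  rewrite mulmx_sumr -sumrB -big_split; apply: eq_bigr => j _ /=.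
  rewrite -scalemxAr -/(A i j) -/(B i j) mulmxBr scalerBl addrA -scalerDr.
  congr (A i j *: _ - _).
  rewrite /f; move: (M *m v j) (M *m v i) => p q.
  by apply/colP => l; rewrite !mxE; ring.
rewrite mulrDr.
have dis : \sum_i dot (f i) (N%:R^-1 *: \sum_j A i j *: (f j - f i)) <= 0.
  apply: dissipation => // i j; first by rewrite /A enormBC.
  by rewrite ltW// a_pos// enorm_ge0.
suff H : 2 * \sum_i dot (f i) (N%:R^-1 *: \sum_j (A i j - B i j) *: (w j - w i)) <=
   3 / 2 * (La * om) * (\sum_i enorm (f i) ^+ 2 + \sum_i enorm (g i) ^+ 2)
    + kappa * \sum_i enorm (f i) ^+ 2 + N%:R * (La * om * eta) ^+ 2 / kappa by lra.
set F := \sum_i enorm (f i) ^+ 2; set G := \sum_i enorm (g i) ^+ 2.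
have L0 : 0 <= La * om by rewrite mulr_ge0.
(* The weights 3/2 and 2/3 are the Young weights for the position errors. Summing
   [enorm (g i - g j) ^+ 2] doubles the second one to 4/3, still below 3/2, so both sums get the
   same coefficient. *)
pose T i j := kappa * enorm (f i) ^+ 2 + (La * om * eta) ^+ 2 / kappa
  + La * om * (3 / 2 * enorm (f i) ^+ 2 + 2 / 3 * enorm (g i - g j) ^+ 2).
have hT i j : 2 * dot (f i) ((A i j - B i j) *: (w j - w i)) <= T i j.
  have AB : `|A i j - B i j| <= La * (eta + enorm (g i - g j)).
    rewrite /A /B; apply: le_trans (a_lip (enorm_ge0 _) (enorm_ge0 _)) _.
    rewrite ler_wpM2l//.
    rewrite -(subrKA (enorm (M *m (x i - x j)))); apply: le_trans (ler_normD _ _) _.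
    rewrite lerD// (le_trans (enorm_leB _ _))// mulmxBr.
    rewrite le_eqVlt; apply/orP; left; apply/eqP; congr enorm; rewrite /g.
    move: (M *m x i) (M *m x j) => p q.
    by apply/colP => l; rewrite !mxE; ring.
  have h1 : dot (f i) ((A i j - B i j) *: (w j - w i)) <=
      enorm (f i) * (La * (eta + enorm (g i - g j)) * om).
    apply: le_trans (dot_le _ _) _; rewrite enormZ ler_wpM2l ?enorm_ge0//.
    by rewrite ler_pM ?normr_ge0 ?enorm_ge0.
  have f0 := enorm_ge0 (f i).
  have h2 : 2 * (enorm (f i) * (La * om * eta)) <=
      kappa * enorm (f i) ^+ 2 + (La * om * eta) ^+ 2 / kappa.
    rewrite -subr_ge0.
    have -> : kappa * enorm (f i) ^+ 2 + (La * om * eta) ^+ 2 / kappa -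
       2 * (enorm (f i) * (La * om * eta)) =
       (kappa * enorm (f i) - La * om * eta) ^+ 2 / kappa.
      by field; rewrite gt_eqF.
    by rewrite divr_ge0 ?sqr_ge0 ?ltW.
  have h3 : 2 * (enorm (f i) * enorm (g i - g j)) <=
      3 / 2 * enorm (f i) ^+ 2 + 2 / 3 * enorm (g i - g j) ^+ 2.
    have := sqr_ge0 (3 / 2 * enorm (f i) - enorm (g i - g j)); nra.
  have h4 := ler_wpM2l L0 h3.
  rewrite /T; nra.
have -> : 2 * \sum_i dot (f i) (N%:R^-1 *: \sum_j (A i j - B i j) *: (w j - w i)) =
   N%:R^-1 * \sum_i \sum_j 2 * dot (f i) ((A i j - B i j) *: (w j - w i)).
  rewrite !mulr_sumr; apply: eq_bigr => i _; rewrite dotZr dot_sumr mulrCA.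
  by rewrite mulr_sumr.
rewrite ler_pdivrMl//.
apply: le_trans (ler_sum _ (fun i _ => ler_sum _ (fun j _ => hT i j))) _.
have -> : \sum_i \sum_j T i j =
   N%:R * (kappa * F) + N%:R * (N%:R * (La * om * eta) ^+ 2 / kappa)
   + La * om * (3 / 2 * (N%:R * F) + 2 / 3 * (2 * N%:R * \sum_i enorm (perp g i) ^+ 2)).
  have c (z : R) : \sum_(j < N) z = N%:R * z by rewrite sumr_const card_ord mulr_natl.
  rewrite -sum_dist_sqr// /T.
  transitivity (\sum_(i < N) (
    (N%:R * kappa + La * om * (3 / 2 * N%:R)) * enorm (f i) ^+ 2
    + N%:R * ((La * om * eta) ^+ 2 / kappa)
    + La * om * (2 / 3) * \sum_(j < N) enorm (g i - g j) ^+ 2)).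
    apply: eq_bigr => i _; rewrite big_split/= c -mulr_sumr big_split/= c -mulr_sumr.
    by ring.
  by rewrite !big_split/= c -!mulr_sumr -/F; ring.
have h := sum_perp_le N0 g; rewrite -/G in h.
have := ler_wpM2l L0 (ler_wpM2l (ler0n R N) h).
have : 0 <= La * om * (N%:R * G).
  by rewrite !mulr_ge0 ?ler0n// sumr_ge0// => i _; exact: sqr_ge0.
lra.
Qed.

Definition proj_error (x v : 'I_N -> 'cV[R]_d) (y w : 'I_N -> 'cV[R]_k) : R :=
  \sum_i enorm (M *m v i - w i) ^+ 2 + \sum_i enorm (M *m x i - y i) ^+ 2.

Lemma perp_error_le x v y w i :
  enorm (M *m perp v i - perp w i) ^+ 2 <= proj_error x v y w.
Proof.
rewrite -perp_mulmx -(perpB (fun i => M *m v i)).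
apply: le_trans (_ : \sum_i enorm (M *m v i - w i) ^+ 2 <= _); last first.
  by rewrite lerDl sumr_ge0// => j _; exact: sqr_ge0.
apply: le_trans (sum_perp_le N0 _).
by rewrite [leRHS](bigD1 i)//= lerDl sumr_ge0// => j _; exact: sqr_ge0.
Qed.

Lemma error_step (s e kappa om eta nu : R) (x v : R -> 'I_N -> 'cV[R]_d)
    (y w : R -> 'I_N -> 'cV[R]_k) (Uh : 'I_N -> 'cV[R]_d) (Ul : 'I_N -> 'cV[R]_k)
    (iota : 'I_N) :
  0 <= s -> s <= e -> 0 < kappa -> 0 <= om -> 0 <= eta ->
  (forall i, vderiv_on s e (x ^~ i) (v ^~ i)) ->
  (forall i, vderiv_on s e (v ^~ i) (fun t => alignment a (x t) (v t) i + Uh i)) ->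
  (forall i, vderiv_on s e (y ^~ i) (w ^~ i)) ->
  (forall i, vderiv_on s e (w ^~ i) (fun t => alignment a (y t) (w t) i + Ul i)) ->
  (forall i, i != iota -> Uh i = 0 /\ Ul i = 0) ->
  enorm (M *m Uh iota - Ul iota) <=
    nu + kappa * enorm (M *m perp (v s) iota - perp (w s) iota) ->
  (forall t i j, s < t < e -> enorm (w t j - w t i) <= om) ->
  (forall t i j, s < t < e ->
     `|enorm (x t i - x t j) - enorm (M *m (x t i - x t j))| <= eta) ->
  let err t := proj_error (x t) (v t) (y t) (w t) in
  let lambda := 3 * kappa + 3 / 2 * (La * om) + 1 in
  let D := (N%:R * (La * om * eta) ^+ 2 + nu ^+ 2) / kappa in
  err s <= D * s * expR ((lambda + kappa) * s) ->
  err e <= D * e * expR ((lambda + kappa) * e).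
Proof.
move=> s0 se k0 om0 eta0 hx hv hy hw U0 hU hwb hgap err lambda D.
have L0 : 0 <= La * om by rewrite mulr_ge0.
have hf i := vderiv_onB (vderiv_on_mulmx M (hv i)) (hw i).
have hg i := vderiv_onB (vderiv_on_mulmx M (hx i)) (hy i).
have hE := deriv_onD (deriv_on_sumsq hf) (deriv_on_sumsq hg).
have D0 : 0 <= D.
  by rewrite divr_ge0 ?(ltW k0)// addr_ge0 ?sqr_ge0// mulr_ge0 ?sqr_ge0 ?ler0n.
apply: (delayed_gronwall s0 se _ (ltW k0) D0 hE); first by rewrite /lambda; lra.
move=> t st /=.
set f := fun i => M *m v t i - w t i; set g := fun i => M *m x t i - y t i.
pose F := \sum_i enorm (f i) ^+ 2; pose G := \sum_i enorm (g i) ^+ 2.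
have errE : err t = F + G by [].
have h1 := @alignment_error (x t) (v t) (y t) (w t) kappa om eta k0 om0 eta0
  (fun i j => hwb t i j st) (fun i j => hgap t i j st).
rewrite -/F -/G in h1.
have -> : \sum_i dot (M *m v t i - w t i)
   (M *m (alignment a (x t) (v t) i + Uh i) - (alignment a (y t) (w t) i + Ul i)) =
   \sum_i dot (f i) (M *m alignment a (x t) (v t) i - alignment a (y t) (w t) i)
   + dot (f iota) (M *m Uh iota - Ul iota).
  transitivity (\sum_i (
    dot (f i) (M *m alignment a (x t) (v t) i - alignment a (y t) (w t) i)
    + dot (f i) (M *m Uh i - Ul i))).
    apply: eq_bigr => i _; rewrite -dotDr mulmxDr opprD addrACA //.
  rewrite big_split/=; congr (_ + _).
  rewrite (bigD1 iota)//= big1 ?addr0// => i /U0[-> ->].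
  by rewrite mulmx0 subrr dot0r.
have fF : enorm (f iota) ^+ 2 <= F.
  by rewrite /F (bigD1 iota)//= lerDl sumr_ge0// => j _; exact: sqr_ge0.
set e0 := enorm (M *m perp (v s) iota - perp (w s) iota) in hU.
have e0E : e0 ^+ 2 <= err s by exact: perp_error_le.
have e00 : 0 <= e0 by exact: enorm_ge0.
have f0 := enorm_ge0 (f iota).
have h2 : 2 * dot (f iota) (M *m Uh iota - Ul iota) <=
    2 * kappa * F + nu ^+ 2 / kappa + kappa * err s.
  have h3 := le_trans (dot_le _ _) (ler_wpM2l f0 hU).
  have h4 : 2 * (enorm (f iota) * nu) <= kappa * enorm (f iota) ^+ 2 + nu ^+ 2 / kappa.
    rewrite -subr_ge0.
    have -> : kappa * enorm (f iota) ^+ 2 + nu ^+ 2 / kappa -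
       2 * (enorm (f iota) * nu) = (kappa * enorm (f iota) - nu) ^+ 2 / kappa.
      by field; rewrite gt_eqF.
    by rewrite divr_ge0 ?sqr_ge0 ?ltW.
  have h5 : kappa * (2 * (enorm (f iota) * e0)) <= kappa * (F + err s).
    rewrite ler_wpM2l ?(ltW k0)//.
    have := sqr_ge0 (enorm (f iota) - e0); nra.
  have := ler_wpM2l (ltW k0) fF; nra.
have h6 : 2 * \sum_i dot (g i) (f i) <= F + G.
  rewrite mulr_sumr /F /G -big_split; apply: ler_sum => i _ /=.
  rewrite !enorm_sqr; move: (f i) (g i) => p q; have := dot_ge0 (p - q).
  by rewrite !dotBr !dotBl (dotC q p); lra.
have G0 : 0 <= G by apply: sumr_ge0 => i _; exact: sqr_ge0.
have kG : 0 <= kappa * G by rewrite mulr_ge0 ?(ltW k0).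
set P := \sum_i dot (f i) _ in h1 *; set Q := dot (f iota) _ in h2 *.
change (2 * (P + Q) + 2 * \sum_i dot (g i) (f i) <=
  lambda * (F + G) + kappa * err s + D).
rewrite /lambda /D; lra.
Qed.

End ErrorStep.

(** * Tail integral, sparse control and the smallness condition *)

Section Gamma.
Context {R : realType} {N : nat} (a : R -> R).
Hypothesis a_pos : forall r, 0 <= r -> 0 < a r.
Hypothesis a_mono : forall r s, 0 <= r -> r <= s -> a s <= a r.

Lemma gamma_le (X1 X2 : R) : X1 <= X2 -> (gamma N a X2 <= gamma N a X1)%E.
Proof.
move=> X12; apply: ge0_subset_integral => //=.
(* [a] is monotone only on the half-line, so its argument is truncated at 0 to get a globally
   monotone, hence measurable, function. *)
- pose f r := a (Num.sqrt (2 * N%:R) * Num.max r 0).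
  apply/measurable_EFinP.
  apply: (@eq_measurable_fun _ _ _ _ _ f).
    move=> r; rewrite inE/= in_itv/= andbT => rX; rewrite /f max_l//.
    exact: le_trans (sqrtr_ge0 _) rX.
  apply: nonincreasing_measurable => // r s rs; rewrite /f.
  apply: a_mono; first by rewrite mulr_ge0 ?sqrtr_ge0// le_max lexx orbT.
  by rewrite ler_wpM2l ?sqrtr_ge0// ge_max !le_max rs lexx orbT.
- move=> r; rewrite in_itv/= andbT => rX; rewrite lee_fin ltW// a_pos//.
  by rewrite mulr_ge0 ?sqrtr_ge0// (le_trans (sqrtr_ge0 _) rX).
- move=> r /=; rewrite !in_itv/= !andbT; apply: le_trans.
  exact: ler_wsqrtr.
Qed.

End Gamma.

Section Control.
Context {R : realType} {N : nat}.

(** The least index among the maximizers is unique, so the control acts on exactly one agent. *)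
Lemma exists_first_max {m : nat} (z : 'I_N -> 'cV[R]_m) : (0 < N)%N ->
  exists2 iota, (forall j, enorm (perp z j) <= enorm (perp z iota)) &
    forall i, is_first_max z i = (i == iota).
Proof.
move=> N0; pose P (i : 'I_N) := [forall j : 'I_N, enorm (perp z j) <= enorm (perp z i)].
have [i0 _ hi0] := @arg_maxP _ _ _ (Ordinal N0) xpredT (fun i => enorm (perp z i)) isT.
have Pi0 : P i0 by apply/forallP => j; exact: hi0.
have [i Pi hi] := arg_minnP (fun i : 'I_N => val i) Pi0.
exists i; first by move=> j; exact: (forallP Pi).
move=> j; apply/idP/eqP => [/andP[/forallP Pj /forallP Lj]|->].
  apply/eqP; rewrite -val_eqE eqn_leq hi ?andbT; last exact/forallP.
  rewrite leqNgt; apply/negP => ij; have := implyP (Lj i) ij.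
  by rewrite ltNge (forallP Pi).
apply/andP; split=> //; apply/forallP => l; apply/implyP => li.
rewrite ltNge; apply/negP => il.
have /hi : P l by apply/forallP => r; apply: le_trans il; exact: (forallP Pi).
by rewrite leqNgt li.
Qed.

Lemma le_switch_off_time {k : nat} (Gamma : R) (w : R -> 'I_N -> 'cV[R]_k) (t : R) :
  (forall r, 0 <= r < t -> Gamma < spread (w r)) -> (t%:E <= switch_off_time Gamma w)%E.
Proof.
move=> h; apply: le_ereal_inf_tmp => _ [r [r0 hr] <-].
rewrite lee_fin leNgt; apply/negP => rt.
by have := h r; rewrite r0 rt ltNge hr => /(_ isT).
Qed.

End Control.

(* Here [sn], [sv], [sx] stand for the square roots of N, V(0), 2 X(0).  The term
   [3 / 2 * (T * sv)] of [eta] is the drift of the positions, which the smallness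
   hypothesis (with [alpha] instead of [alpha * V(0)]) does not contain.  It is
   absorbed by the surplus [expR (T * (8 - 2) * theta / Delta)] in the exponent,
   thanks to the two lower bounds on [theta * T]. *)
Lemma smallness_gronwall (R : realType) (n sn La sv sx alpha theta Delta T eps a0 : R) :
  1 <= n -> 0 <= sn -> sn ^+ 2 = n -> 0 <= La -> 0 <= sv -> 0 <= sx -> 0 <= alpha ->
  0 < theta -> 0 < Delta -> 0 <= T -> 0 <= eps -> 0 <= a0 ->
  n * sv <= theta * T -> 4 / 3 * n <= theta / Delta * T ->
  let kappa := theta / Delta in
  let om := 9 / 4 * (sn * sv) in
  let eta := eps * (sn * (sx + 3 / 2 * (T * sv)) + (sx + alpha) / 2) in
  let lambda := 3 * kappa + 3 / 2 * (La * om) + 1 in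
  eps * sn * (4 * La * (sn * sv) * (sx + alpha) + theta / sn) * T *
    expR (T * (Num.max (2 * a0 + 1) (4 * La * (sn * sv)) + 8 * theta / Delta)) <=
    Delta / 2 ->
  (n * (La * om * eta) ^+ 2 + (theta * eps) ^+ 2) / kappa * T
    * expR ((lambda + kappa) * T) <= (Delta / 2) ^+ 2.
Proof.
move=> n1 sn0 snn La0 sv0 sx0 al0 th0 D0 T0 eps0 a00 hT hp kappa om eta lambda heps.
have sn1 : 1 <= sn.
  rewrite leNgt; apply/negP => sn1; suff : sn ^+ 2 < 1 by rewrite snn ltNge n1.
  by rewrite expr_lt1.
have snn' : sn <= n by rewrite -snn expr2 ler_peMr.
pose K := 4 * La * (sn * sv); rewrite -/K in heps.
set mm := Num.max _ _ in heps.
have K0 : 0 <= K by rewrite /K !mulr_ge0.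
have mK : K <= mm by rewrite /mm le_max lexx orbT.
have m1 : 1 <= mm by rewrite /mm le_max lerDr mulr_ge0.
have k0 : 0 < kappa by rewrite divr_gt0.
pose u := mm * T; pose p := kappa * T.
have u0 : 0 <= u by rewrite mulr_ge0// (le_trans ler01).
have hp' : 4 / 3 * n <= p by [].
have p1 : 1 <= p by lra.
pose A := sn * K * (sx + alpha).
have A0 : 0 <= A by rewrite !mulr_ge0 ?addr_ge0.
have E1 : sn * (La * om * eta) <= eps * ((A + theta) * (n + u ^+ 2)).
  have -> : sn * (La * om * eta) =
      eps * (9 / 16 * (sn * (sn * K * sx) + 3 / 2 * (K * (n * sv) * T) + A / 2)).
    by rewrite /om /eta /A /K -snn; field.
  rewrite ler_wpM2l//.
  have h1 : sn * (sn * K * sx) <= n * A.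
    by rewrite ler_pM ?mulr_ge0// /A ler_wpM2l ?mulr_ge0// lerDl.
  (* The drift term: [n * sv <= theta * T] trades [sv] for [theta], and [1 <= mm] turns
     [mm * T ^+ 2] into at most [u ^+ 2]. *)
  have h2 : K * (n * sv) * T <= theta * u ^+ 2.
    apply: (@le_trans _ _ (mm * (theta * T) * T)).
      rewrite ler_wpM2r// ler_pM//.
      by rewrite mulr_ge0// (le_trans ler01 n1).
    rewrite /u exprMn.
    have -> : mm * (theta * T) * T = theta * (mm * T ^+ 2) by ring.
    rewrite ler_wpM2l ?(ltW th0)// ler_wpM2r ?sqr_ge0// expr2 ler_peMr//.
    exact: le_trans m1.
  have h3 : A <= n * A by rewrite ler_peMl.
  have h4 : 0 <= A * u ^+ 2 by rewrite mulr_ge0 ?sqr_ge0.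
  have h5 : 0 <= theta * u ^+ 2 by rewrite mulr_ge0 ?sqr_ge0 ?ltW.
  have h6 : 0 <= theta * n by rewrite mulr_ge0 ?(ltW th0)// (le_trans ler01).
  nra.
have E2 : n * (La * om * eta) ^+ 2 + (theta * eps) ^+ 2 <=
    (eps * (A + theta)) ^+ 2 * (n + u ^+ 2 + 1) ^+ 2.
  have q0 : 0 <= n + u ^+ 2 by rewrite addr_ge0 ?sqr_ge0// (le_trans ler01).
  have At : 0 <= A + theta by rewrite addr_ge0// ltW.
  have -> : n * (La * om * eta) ^+ 2 = (sn * (La * om * eta)) ^+ 2.
    by rewrite [RHS]exprMn snn.
  have om0 : 0 <= La * om by rewrite !mulr_ge0.
  have eta0 : 0 <= eta.
    by rewrite mulr_ge0// addr_ge0 ?mulr_ge0 ?addr_ge0 ?mulr_ge0.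
  have h1 : (sn * (La * om * eta)) ^+ 2 <= (eps * ((A + theta) * (n + u ^+ 2))) ^+ 2.
    have l0 : 0 <= sn * (La * om * eta) by rewrite mulr_ge0// mulr_ge0.
    by rewrite lerXn2r ?nnegrE// (le_trans l0 E1).
  have h2 : (theta * eps) ^+ 2 <= (eps * (A + theta)) ^+ 2.
    by rewrite lerXn2r ?nnegrE ?mulr_ge0 ?(ltW th0)// mulrC ler_wpM2l// lerDr.
  apply: le_trans (lerD h1 h2) _.
  rewrite [eps * (_ * _)]mulrA; move: (eps * (A + theta)) => W.
  have : 0 <= W ^+ 2 * (n + u ^+ 2) by rewrite mulr_ge0 ?sqr_ge0.
  move: (n + u ^+ 2) => q; rewrite exprMn.
  have -> : (q + 1) ^+ 2 = q ^+ 2 + 2 * q + 1 by ring.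
  lra.
have E3 : n + u ^+ 2 + 1 <= expR (5 / 64 * u + 6 * p).
  (* Since [p] is at least 4/3, [6 * p] is at least 8, and the exponential of 8 is at least
     (5/4)^32, which exceeds 1000. *)
  have q1 : 1000 <= expR (6 * p).
    have h : expR 8 <= expR (6 * p) by rewrite ler_expR; lra.
    apply: le_trans h; have -> : (8 : R) = 32%:R * (1 / 4) by lra.
    rewrite expRM_natl.
    have : (5 / 4) ^+ 32 <= expR (1 / 4) ^+ 32 :> R.
      rewrite lerXn2r ?nnegrE ?expR_ge0//; last by have := expR_ge1Dx (1 / 4 : R); lra.
    by apply: le_trans; lra.
  have q2 : n + 1 <= expR (6 * p).
    by have := expR_ge1Dx (6 * p); lra.
  have q3 : 1 + 1 / 1000 * u ^+ 2 <= expR (5 / 64 * u).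
    have -> : 5 / 64 * u = 2%:R * (5 / 128 * u) by lra.
    rewrite expRM_natl.
    apply: (@le_trans _ _ ((1 + 5 / 128 * u) ^+ 2)); first nra.
    rewrite lerXn2r ?nnegrE ?expR_ge0 ?expR_ge1Dx//.
    by rewrite addr_ge0// mulr_ge0.
  rewrite expRD; apply: (@le_trans _ _ ((1 + 1 / 1000 * u ^+ 2) * expR (6 * p))).
    have := ler_wpM2r (sqr_ge0 u) q1; lra.
  by rewrite ler_wpM2r ?expR_ge0.
(* The coefficient 59/32 is 27/32 from [K <= mm] plus 1 from [1 <= mm]. *)
have E4 : expR ((lambda + kappa) * T) <= expR (4 * p + 59 / 32 * u).
  rewrite ler_expR.
  have -> : (lambda + kappa) * T = 4 * p + (27 / 32 * K + 1) * T.
    by rewrite /lambda /om /p /K; field.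
  have -> : 59 / 32 * u = 59 / 32 * mm * T by rewrite /u; ring.
  by rewrite lerD2l ler_wpM2r//; lra.
have heps' : (eps * (A + theta) * T) * expR (u + 8 * p) <= Delta / 2.
  apply: le_trans heps; rewrite le_eqVlt; apply/orP; left; apply/eqP.
  congr (_ * expR _).
    by rewrite /A; field; rewrite gt_eqF// (lt_le_trans ltr01).
  by rewrite /u /p /kappa; field; rewrite gt_eqF.
set B := eps * (A + theta) * T in heps'.
have B0 : 0 <= B by rewrite !mulr_ge0// addr_ge0// ltW.
apply: (@le_trans _ _ ((B * expR (u + 8 * p)) ^+ 2)); last first.
  have BE := mulr_ge0 B0 (expR_ge0 (u + 8 * p)).
  by rewrite lerXn2r ?nnegrE// (le_trans BE heps').
have E5 : (n * (La * om * eta) ^+ 2 + (theta * eps) ^+ 2) / kappa * T <=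
    B ^+ 2 * (n + u ^+ 2 + 1) ^+ 2.
  have -> : B ^+ 2 * (n + u ^+ 2 + 1) ^+ 2 =
     (eps * (A + theta)) ^+ 2 * (n + u ^+ 2 + 1) ^+ 2 * T ^+ 2 by rewrite /B; ring.
  rewrite -mulrA; apply: ler_pM => //.
  - by rewrite addr_ge0 ?sqr_ge0// mulr_ge0 ?sqr_ge0// (le_trans ler01).
  - by rewrite mulr_ge0// invr_ge0 ltW.
  (* [p >= 1] says that [1 / kappa] is at most [T]. *)
  - by rewrite ler_pdivrMl// expr2 mulrA ler_peMl.
apply: le_trans (ler_pM _ _ E5 E4) _; rewrite ?expR_ge0//.
  rewrite mulr_ge0// divr_ge0 ?(ltW k0)//.
  by rewrite addr_ge0 ?sqr_ge0// mulr_ge0 ?sqr_ge0// (le_trans ler01).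
rewrite [leRHS](exprMn _ B) -[leLHS](mulrA (B ^+ 2)) ler_wpM2l ?sqr_ge0//.
apply: (@le_trans _ _ (expR (5 / 64 * u + 6 * p) ^+ 2 * expR (4 * p + 59 / 32 * u))).
  rewrite ler_wpM2r ?expR_ge0// lerXn2r// nnegrE ?expR_ge0//.
  by rewrite !addr_ge0 ?sqr_ge0// (le_trans ler01).
rewrite -!expRM_natl -expRD ler_expR; lra.
Qed.

(** * Induction over the sampling times *)

Lemma strong_JL_spread (R : realType) (N k d : nat) (M : 'M[R]_(k, d))
    (z : 'I_N -> 'cV[R]_d) : (0 < N)%N ->
  (forall i, strong_JL M (1 / 2) (perp z i)) ->
  Num.sqrt (spread (fun i => M *m z i)) <= 3 / 2 * Num.sqrt (spread z) /\
  Num.sqrt (spread z) <= 2 * Num.sqrt (spread (fun i => M *m z i)).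
Proof.
move=> N0 h.
have NV : 0 <= N%:R^-1 :> R by rewrite invr_ge0 ler0n.
have cs (c X : R) : 0 <= c -> c * Num.sqrt X = Num.sqrt (c ^+ 2 * X).
  by move=> c0; rewrite sqrtrM ?sqr_ge0// sqrtr_sqr ger0_norm.
rewrite !cs; [|lra..].
split; rewrite ler_wsqrtr// !spreadE// mulrCA ler_wpM2l// mulr_sumr;
  apply: ler_sum => i _; rewrite -exprMn lerXn2r ?nnegrE ?mulr_ge0 ?enorm_ge0//;
  rewrite perp_mulmx; have [l u] := h i; lra.
Qed.

Lemma sampling_solution_vderiv (R : realType) (N m : nat) (a : R -> R) (tau : R)
    (u : R -> 'I_N -> 'cV[R]_m) (p0 q0 : 'I_N -> 'cV[R]_m)
    (p q : R -> 'I_N -> 'cV[R]_m) (n : nat) : 0 <= tau ->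
  sampling_solution a tau u p0 q0 p q -> forall i,
  vderiv_on (n%:R * tau) (n.+1%:R * tau) (p ^~ i) (q ^~ i) /\
  vderiv_on (n%:R * tau) (n.+1%:R * tau) (q ^~ i)
    (fun t => alignment a (p t) (q t) i + u (n%:R * tau) i).
Proof.
move=> tau0 [_ hc hd] i; have n0 : 0 <= n%:R * tau by rewrite mulr_ge0 ?ler0n.
have [cp cq] := hc i.
by split; apply: vderiv_onP => // t /(hd n i)[].
Qed.

Section Consensus.
Context {R : realType} {N k d : nat}.
Variables (theta : R) (a : R -> R) (La : R) (Delta That tau : R).
Variables (M : 'M[R]_(k, d)) (alpha eps : R).
Variables (x v : R -> 'I_N -> 'cV[R]_d) (y w : R -> 'I_N -> 'cV[R]_k).
Hypothesis N0 : (0 < N)%N.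
Hypothesis th0 : 0 < theta.
Hypothesis a_pos : forall r, 0 <= r -> 0 < a r.
Hypothesis a_mono : forall r s, 0 <= r -> r <= s -> a s <= a r.
Hypothesis La0 : 0 <= La.
Hypothesis a_lip : forall r s, 0 <= r -> 0 <= s -> `|a r - a s| <= La * `|r - s|.
Hypothesis D0 : 0 < Delta.
Hypothesis tau0 : 0 < tau.
Hypothesis htau : tau * (a 0 * Num.sqrt N%:R * Num.sqrt (spread (v 0)) + theta)
                 + tau ^+ 2 * a 0 * theta <= Delta / 4.
Hypothesis hThat : That = 2 * N%:R / theta * (2 * Num.sqrt (spread (v 0)) - 2 * Delta).
Hypothesis al0 : 0 <= alpha.
Hypothesis eps0 : 0 <= eps.
Hypothesis hxv : sampling_solution a tau
   (sparse_control theta ((2 * Delta) ^+ 2) w v) (x 0) (v 0) x v.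
Hypothesis hyw : sampling_solution a tau
   (sparse_control theta ((2 * Delta) ^+ 2) w w)
   (fun i => M *m x 0 i) (fun i => M *m v 0 i) y w.
Hypothesis heps : eps * Num.sqrt N%:R
     * (4 * La * Num.sqrt (N%:R * spread (v 0)) * (Num.sqrt (2 * spread (x 0)) + alpha)
        + theta / Num.sqrt N%:R)
     * (That + tau)
     * expR ((That + tau)
             * (Num.max (2 * a 0 + 1) (4 * La * Num.sqrt (N%:R * spread (v 0)))
                + 8 * theta / Delta))
     <= Delta / 2.
Hypothesis JL1 : forall (i j : 'I_N) (t : R), 0 <= t <= That + tau ->
     weak_JL M eps (eps * ((Num.sqrt (2 * spread (x 0)) + alpha) / 2)) (x t i - x t j).
Hypothesis JL2 : forall (i : 'I_N) (n : nat),
     (n%:Z <= Num.floor (That / tau) + 1)%R ->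
     weak_JL M eps Delta (perp (v (n%:R * tau)) i).
Hypothesis JL3v : forall i, strong_JL M (1 / 2) (perp (v 0) i).
Hypothesis JL3x : forall i, strong_JL M (1 / 2) (perp (x 0) i).

Local Notation V0 := (spread (v 0)).
Local Notation X0 := (spread (x 0)).
Local Notation sqV t := (Num.sqrt (spread (v t))).
Local Notation sqX t := (Num.sqrt (spread (x t))).
Local Notation sqW t := (Num.sqrt (spread (w t))).
Local Notation sqY t := (Num.sqrt (spread (y t))).
Let NR0 : 0 < N%:R :> R. Proof. by rewrite ltr0n. Qed.
Let N1 : 1 <= N%:R :> R. Proof. by rewrite ler1n. Qed.

Lemma init_w : w 0 = fun i => M *m v 0 i.
Proof. by case: hyw => h _ _; apply/funext => i; have [] := h i. Qed.

Lemma init_y : y 0 = fun i => M *m x 0 i.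
Proof. by case: hyw => h _ _; apply/funext => i; have [] := h i. Qed.

Lemma init_bounds : [/\ sqW 0 <= 3 / 2 * sqV 0, sqV 0 <= 2 * sqW 0
  & sqY 0 <= 3 / 2 * sqX 0].
Proof.
rewrite init_w init_y.
have [? ?] := strong_JL_spread N0 JL3v; have [? _] := strong_JL_spread N0 JL3x.
by split.
Qed.

(** * Sampling intervals with active control *)

Section Active.
Hypothesis hW0 : 2 * Delta < sqW 0.

Let kappa := theta / Delta.
Let T := That + tau.
(** [om] bounds the differences of the [w i]: one factor 3/2 for the square root of 2, another for
    [sqW 0] against [sqV 0]. [eta] bounds the distortion of distances between the [x i], from their
    initial size and their drift up to time [T]. *)
Let om := 9 / 4 * (Num.sqrt N%:R * sqV 0).
Let eta := eps * (Num.sqrt N%:R * (Num.sqrt (2 * X0) + 3 / 2 * (T * sqV 0))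
  + (Num.sqrt (2 * X0) + alpha) / 2).
Let lambda := 3 * kappa + 3 / 2 * (La * om) + 1.
Let D := (N%:R * (La * om * eta) ^+ 2 + (theta * eps) ^+ 2) / kappa.
Let err t := proj_error M (x t) (v t) (y t) (w t).

Let k0 : 0 < kappa. Proof. by rewrite divr_gt0. Qed.
Let om0 : 0 <= om. Proof. by rewrite mulr_ge0 ?mulr_ge0 ?sqrtr_ge0. Qed.

Lemma sqV0_gt : 4 / 3 * Delta < sqV 0.
Proof. by have [h _ _] := init_bounds; have := hW0; lra. Qed.

(** [theta * That] is 4 N times [sqV 0 - Delta], and [Delta] is less than three quarters of
    [sqV 0]. *)
Lemma sqV0_le_That : N%:R * sqV 0 <= theta * That.
Proof.
have -> : theta * That = N%:R * (4 * (sqV 0 - Delta)).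
  by rewrite hThat; field; rewrite gt_eqF.
by rewrite ler_pM2l//; have := sqV0_gt; lra.
Qed.

Lemma That_ge : 4 / 3 * N%:R <= kappa * That.
Proof.
have -> : kappa * That = N%:R * (4 * (sqV 0 - Delta)) / Delta.
  by rewrite /kappa hThat; field; rewrite !gt_eqF.
rewrite ler_pdivlMr// [4 / 3 * _]mulrC -mulrA ler_pM2l//; have := sqV0_gt; lra.
Qed.

Let That0 : 0 <= That.
Proof.
have : 0 <= kappa * That.
  by apply: le_trans That_ge; rewrite mulr_ge0 ?ler0n.
by rewrite pmulr_rge0.
Qed.
Let T0 : 0 <= T. Proof. by rewrite addr_ge0// ltW. Qed.
Let ThatT : That <= T. Proof. by rewrite lerDl ltW. Qed.

Lemma error_final : D * T * expR ((lambda + kappa) * T) <= (Delta / 2) ^+ 2.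
Proof.
apply: (smallness_gronwall (a0 := a 0)) => //.
- by rewrite sqr_sqrtr// ler0n.
- exact: (ltW (a_pos (lexx 0))).
- by rewrite (le_trans sqV0_le_That)// ler_wpM2l// ltW.
- by rewrite (le_trans That_ge)// ler_wpM2l// ltW.
- by move: heps; rewrite sqrtrM ?ler0n.
Qed.

(** Keeping only the [theta] term of the smallness condition gives [eps * theta * T <= Delta / 2],
    and [kappa * T] is at least 1. *)
Lemma eps_le_half : eps <= 1 / 2.
Proof.
have sN : 0 < Num.sqrt N%:R :> R by rewrite sqrtr_gt0.
have p1 : 1 <= kappa * T.
  have := ler_wpM2l (ltW k0) ThatT; have := That_ge; have := N1; lra.
have h1 : eps * theta * T <= Delta / 2.
  apply: le_trans heps.
  apply: (@le_trans _ _ (eps * theta * T * 1)); first by rewrite mulr1.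
  apply: ler_pM => //; first by rewrite !mulr_ge0// ltW.
    set A := 4 * La * _ * _.
    have A0 : 0 <= A by rewrite !mulr_ge0 ?addr_ge0 ?sqrtr_ge0.
    have -> : eps * Num.sqrt N%:R * (A + theta / Num.sqrt N%:R) =
        eps * (Num.sqrt N%:R * A + theta) by field; rewrite gt_eqF.
    by rewrite ler_wpM2r// ler_wpM2l// lerDr mulr_ge0 ?sqrtr_ge0.
  rewrite -expR0 ler_expR mulr_ge0// addr_ge0//.
    by rewrite le_max addr_ge0// mulr_ge0// ltW// a_pos.
  by rewrite divr_ge0 ?(ltW D0)// mulr_ge0 ?(ltW th0).
have : eps * (kappa * T) <= 1 / 2.
  have -> : eps * (kappa * T) = eps * theta * T / Delta.
    by rewrite /kappa; field; rewrite gt_eqF.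
  by rewrite ler_pdivrMr//; lra.
have := ler_wpM2l eps0 p1; lra.
Qed.

(** The induction invariant. Monotonicity of W keeps the control on, the rate bounds the elapsed
    time, the bounds on V and X feed the estimates of the next interval, the two mixed sums yield
    the bounds by Xbar, and the error bound transfers the choice of agent to the high-dimensional
    system. *)
Record progress (n : nat) : Prop := Progress {
  progress_W : forall t, 0 <= t <= n%:R * tau ->
    spread (w (n%:R * tau)) <= spread (w t) /\ spread (w t) <= spread (w 0);
  progress_rate : sqW (n%:R * tau) <= sqW 0 - theta / (2 * N%:R) * (n%:R * tau);
  progress_V : forall t, 0 <= t <= n%:R * tau -> spread (v t) <= V0;
  progress_XV : forall t, 0 <= t <= n%:R * tau ->
    sqX t + 17 * N%:R / theta * spread (v t) <= sqX 0 + 17 * N%:R / theta * V0;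
  progress_YW : forall t, 0 <= t <= n%:R * tau ->
    sqY t + N%:R / theta * spread (w t) <= sqY 0 + N%:R / theta * spread (w 0);
  progress_X : forall t, 0 <= t <= n%:R * tau -> sqX t <= sqX 0 + t * sqV 0;
  progress_err : forall t, 0 <= t <= n%:R * tau ->
    err t <= D * t * expR ((lambda + kappa) * t) }.

Lemma progress0 : progress 0.
Proof.
have z (t : R) : 0 <= t <= 0%:R * tau -> t = 0.
  by rewrite mul0r => /le_anti.
have e0 : err 0 = 0.
  by rewrite /err /proj_error init_w init_y !big1 ?addr0// => i _;
    rewrite subrr enorm0 expr0n.
split=> [t /z->|| t /z->| t /z->| t /z->| t /z->| t /z->] //; rewrite ?mul0r//.
- by rewrite mulr0 subr0.
- by rewrite addr0.
- by rewrite e0 !mulr0 mul0r.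
Qed.

Let D_ge0 : 0 <= D.
Proof.
rewrite divr_ge0 ?(ltW k0)// addr_ge0 ?sqr_ge0//.
by rewrite mulr_ge0 ?ler0n ?sqr_ge0.
Qed.

Let lambda0 : 0 <= lambda.
Proof.
apply: addr_ge0 => //; apply: addr_ge0; apply: mulr_ge0 => //; first exact: ltW.
exact: mulr_ge0.
Qed.

Lemma projection_gap t i : 0 <= t <= T ->
  err t <= D * t * expR ((lambda + kappa) * t) ->
  enorm (M *m perp (v t) i - perp (w t) i) <= Delta / 2.
Proof.
move=> /andP[t0 tT] h.
have lk : 0 <= lambda + kappa by rewrite addr_ge0// ltW.
rewrite -(@ler_pXn2r _ 2)// ?nnegrE ?enorm_ge0 ?divr_ge0 ?(ltW D0)//.
apply: le_trans (perp_error_le N0 M (x t) (v t) (y t) (w t) i) _.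
apply: le_trans h (le_trans _ error_final).
apply: ler_pM; [exact: mulr_ge0|exact: expR_ge0|exact: ler_wpM2l|].
by rewrite ler_expR ler_wpM2l.
Qed.

(** By this bound the next interval ends before [That + tau], within the range of the
    Johnson-Lindenstrauss assumptions. *)
Lemma active_time n : progress n -> 2 * Delta < sqW (n%:R * tau) -> n%:R * tau <= That.
Proof.
move=> /progress_rate h1 h2.
have [h3 _ _] := init_bounds.
have h4 : theta / (2 * N%:R) * (n%:R * tau) <= 2 * sqV 0 - 2 * Delta.
  by have := sqrtr_ge0 V0; lra.
have -> : n%:R * tau = 2 * N%:R / theta * (theta / (2 * N%:R) * (n%:R * tau)).
  by field; rewrite !gt_eqF.
by rewrite hThat ler_wpM2l// divr_ge0 ?(ltW th0)// mulr_ge0 ?ler0n.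
Qed.

Lemma sample_le_floor n : n%:R * tau <= That -> (n%:Z <= Num.floor (That / tau))%R.
Proof. by move=> h; rewrite floor_ge_int ler_pdivlMr. Qed.

Lemma leader_bounds n iota : progress n -> 2 * Delta < sqW (n%:R * tau) ->
  (forall j, enorm (perp (w (n%:R * tau)) j) <= enorm (perp (w (n%:R * tau)) iota)) ->
  [/\ sqW (n%:R * tau) <= enorm (perp (w (n%:R * tau)) iota),
      Delta <= enorm (perp (v (n%:R * tau)) iota),
      sqV (n%:R * tau) <= 5 * enorm (perp (v (n%:R * tau)) iota)
    & strong_JL M eps (perp (v (n%:R * tau)) iota)].
Proof.
move=> hn hW hmax.
have tT := active_time hn hW; set t := n%:R * tau in hW hmax tT *.
have t0 : 0 <= t by rewrite mulr_ge0 ?ler0n// ltW.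
have gap i : enorm (M *m perp (v t) i - perp (w t) i) <= Delta / 2.
  apply: projection_gap; first by rewrite t0 (le_trans tT).
  by apply: (progress_err hn); rewrite t0 lexx.
have jl i : weak_JL M eps Delta (perp (v t) i).
  by apply: JL2; rewrite (le_trans (sample_le_floor tT))// lerDl.
have e2 := eps_le_half.
have Wle : sqW t <= enorm (perp (w t) iota).
  rewrite -[leRHS]ger0_norm ?enorm_ge0// -sqrtr_sqr ler_wsqrtr//.
  exact: spread_le_max.
have hD := D0.
have near i := enorm_leB (M *m perp (v t) i) (perp (w t) i).
have nearP i : enorm (M *m perp (v t) i) <= enorm (perp (w t) i) + Delta / 2 /\
     enorm (perp (w t) i) <= enorm (M *m perp (v t) i) + Delta / 2.
  by have := le_trans (near i) (gap i); rewrite ler_norml => /andP[? ?]; split; lra.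
have v0 i := enorm_ge0 (perp (v t) i).
(* [M *m perp (v t) iota] is longer than [Delta], which excludes the second
   alternative of the weak property. *)
have strong : strong_JL M eps (perp (v t) iota).
  by case: (jl iota) => // -[_ ?]; have [_ ?] := nearP iota; lra.
have half i := ler_wpM2r (v0 i) e2.
have big : enorm (perp (w t) iota) <= 2 * enorm (perp (v t) iota).
  have [_ u] := strong; have [_ ?] := nearP iota.
  by move: u (half iota); rewrite mulrDl; lra.
split=> //; first lra.
(* Origin of the factor 5: with [eps <= 1 / 2], another agent satisfies [enorm (perp (v t) j) <= 5 /
   2 * enorm (perp (w t) iota)], and [big] supplies a further factor 2. In the weak alternative the
   deviation is at most [Delta]. *)
rewrite -[leRHS]ger0_norm ?mulr_ge0// -sqrtr_sqr ler_wsqrtr//.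
apply: spread_le_max => // j.
case: (jl j) => [[l _]|[l _]]; last lra.
have [? _] := nearP j; have := hmax j.
by move: l (half j); rewrite mulrBl; lra.
Qed.

Lemma progress_step n : progress n -> 2 * Delta < sqW (n%:R * tau) -> progress n.+1.
Proof.
move=> hn hW.
have tT := active_time hn hW.
set s := n%:R * tau in hW tT.
have s0 : 0 <= s by rewrite mulr_ge0 ?ler0n// ltW.
set e := n.+1%:R * tau.
have eE : e = s + tau by rewrite /e -natr1 mulrDl mul1r.
have se : s <= e by rewrite eE lerDl ltW.
have eT : e <= T by rewrite eE lerD2r.
have ss : 0 <= s <= s by rewrite s0 lexx.
have Dp := D0; have thp := th0.
have [iota hmax hfirst] := exists_first_max (w s) N0.
have [Wxi Vxi V5 strong] := leader_bounds hn hW hmax.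
rewrite -/s in Wxi Vxi V5 strong.
(* The switch-off time looks at all real times, so the threshold must also be exceeded between
   samples; there W is at least its value at [s]. *)
have on : (s%:E <= switch_off_time ((2 * Delta) ^+ 2) w)%E.
  apply: le_switch_off_time => r /andP[r0 rs].
  have [h _] : spread (w s) <= spread (w r) /\ spread (w r) <= spread (w 0).
    by apply: (progress_W hn); rewrite r0 ltW.
  apply: lt_le_trans h.
  rewrite -(sqr_sqrtr (spread_ge0 N0 (w s))) ltrXn2r ?nnegrE ?sqrtr_ge0//.
  by rewrite mulr_ge0// ltW.
have ctrl m (q : R -> 'I_N -> 'cV[R]_m) i :
    sparse_control theta ((2 * Delta) ^+ 2) w q s i =
    if i == iota then - (theta / enorm (perp (q s) iota)) *: perp (q s) iota else 0.
  by rewrite /sparse_control on hfirst /=; case: eqP => // ->.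
have hx i := (sampling_solution_vderiv n (ltW tau0) hxv i).1.
have hv i := (sampling_solution_vderiv n (ltW tau0) hxv i).2.
have hy i := (sampling_solution_vderiv n (ltW tau0) hyw i).1.
have hw i := (sampling_solution_vderiv n (ltW tau0) hyw i).2.
rewrite -/s -/e in hx hv hy hw.
have xiw0 : 0 < enorm (perp (w s) iota) by lra.
have xiv0 : 0 < enorm (perp (v s) iota) by lra.
have [W0V0 _ _] := init_bounds.
have ta0 : 0 <= tau * a 0 by rewrite mulr_ge0 ?(ltW tau0)// ltW// a_pos.
have sN0 : 0 <= Num.sqrt N%:R :> R by exact: sqrtr_ge0.
have sqVs : sqV s <= sqV 0 by rewrite ler_wsqrtr// (progress_V hn ss).
have sqWs : sqW s <= 3 / 2 * sqV 0.
  by apply: le_trans W0V0; rewrite ler_wsqrtr// (progress_W hn ss).2.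
have tth : 0 <= tau * theta by rewrite mulr_ge0 ?ltW.
have c1 : 0 <= tau * a 0 * Num.sqrt N%:R * sqV 0 
  by exact: mulr_ge0 (mulr_ge0 ta0 sN0) (sqrtr_ge0 _).
have c2 : 0 <= tau * a 0 * (theta * tau) 
  by exact: mulr_ge0 ta0 (mulr_ge0 (ltW thp) (ltW tau0)).
have hth := htau.
(* The condition on [tau] gives [Delta / 4]. It is multiplied by 3/2 for the square root of 2, and
   for [w] by another 3/2 from comparing [sqW s] with [sqV 0]. *)
have hbw : tau * (a 0 * (3 / 2 * (Num.sqrt N%:R * sqW s + theta * tau)) + theta)
    <= 9 / 16 * Delta.
  have := ler_wpM2l (mulr_ge0 ta0 sN0) sqWs; lra.
have hbv : tau * (a 0 * (3 / 2 * (Num.sqrt N%:R * sqV s + theta * tau)) + theta)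
    <= 3 / 8 * Delta.
  have := ler_wpM2l (mulr_ge0 ta0 sN0) sqVs; lra.
have esT : e - s <= tau by rewrite eE addrAC subrr add0r.
have r1 : 1 / 2 * sqW s <= enorm (perp (w s) iota) - 9 / 16 * Delta by lra.
(* With [rho = c / 2 = 1 / 34] the coefficient [N / (2 theta rho)] of [step_bounds]
   is [N / (c theta)], as required by the definition of Xbar. *)
have r2 : 1 / 34 * sqV s <= enorm (perp (v s) iota) - 3 / 8 * Delta by lra.
have half : 0 < 1 / 2 :> R by lra.
have thin : 0 < 1 / 34 :> R by lra.
have Wb t (st : s <= t <= e) := step_bounds N0 a_pos a_mono (ltW th0) se esT hw xiw0
  (ctrl _ w) hbw r1 th0 half hy st.
have Vb t (st : s <= t <= e) := step_bounds N0 a_pos a_mono (ltW th0) se esT hv xiv0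
  (ctrl _ v) hbv r2 th0 thin hx st.
have ext (Q : R -> Prop) : (forall t, 0 <= t <= s -> Q t) ->
    (forall t, s <= t <= e -> Q t) -> forall t, 0 <= t <= e -> Q t.
  move=> Q1 Q2 t /andP[t0 te]; have [ts|/ltW st] := leP t s.
    by apply: Q1; rewrite t0.
  by apply: Q2; rewrite st.
have see : s <= e <= e by rewrite se lexx.
have nW : forall t, 0 <= t <= e ->
    spread (w e) <= spread (w t) /\ spread (w t) <= spread (w 0).
  apply: ext => t ht.
    have [h1 h2] := progress_W hn ht; have [_ h3 _ _ _] := Wb _ see.
    by split=> //; exact: le_trans h3 h1.
  have [h1 h2 _ _ _] := Wb _ ht; split=> //; apply: le_trans h2 _.
  by have [] := progress_W hn ss.
have nV : forall t, 0 <= t <= e -> spread (v t) <= V0.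
  apply: ext => t ht; first exact: progress_V hn _ ht.
  by have [_ h2 _ _ _] := Vb _ ht; apply: le_trans h2 _; exact: progress_V hn _ ss.
have nX : forall t, 0 <= t <= e -> sqX t <= sqX 0 + t * sqV 0.
  apply: ext => t ht; first exact: progress_X hn _ ht.
  have [_ _ _ h _] := Vb _ ht; have h1 := progress_X hn ss.
  have st : 0 <= t - s by case/andP: ht => ? _; rewrite subr_ge0.
  have := ler_wpM2r st sqVs; lra.
split=> //.
- have [_ _ h _ _] := Wb _ see; have := progress_rate hn; rewrite -/s -/e.
  have -> : theta / (2 * N%:R) * e =
      theta / (2 * N%:R) * s + theta * (1 / 2) / N%:R * (e - s).
    by field; rewrite gt_eqF.
  lra.
- apply: ext => t ht; first exact: progress_XV hn _ ht.
  apply: le_trans (progress_XV hn ss); rewrite -/s; have [_ _ _ _] := Vb _ ht.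
  have -> // : N%:R / (2 * theta * (1 / 34)) = 17 * N%:R / theta.
  by field; rewrite gt_eqF.
- apply: ext => t ht; first exact: progress_YW hn _ ht.
  apply: le_trans (progress_YW hn ss); rewrite -/s; have [_ _ _ _] := Wb _ ht.
  have -> // : N%:R / (2 * theta * (1 / 2)) = N%:R / theta.
  by field; rewrite gt_eqF.
(* The error bound is carried from [s] to every [t] of the new interval, with the delayed control
   error still taken at [s]. *)
apply: ext => t; first exact: progress_err hn _.
move=> /andP[st te].
have lim r : s < r < t -> 0 <= r <= e.
  by move=> /andP[sr rt]; rewrite (le_trans s0 (ltW sr)) (le_trans (ltW rt)).
have eta0 : 0 <= eta.
  by rewrite mulr_ge0// addr_ge0 ?divr_ge0 ?mulr_ge0 ?addr_ge0 ?mulr_ge0 ?sqrtr_ge0.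
apply: (error_step (s := s) (iota := iota) N0 a_pos La0 a_lip s0 st k0 om0 eta0
  (fun i => vderiv_onW (lexx s) te (hx i)) (fun i => vderiv_onW (lexx s) te (hv i))
  (fun i => vderiv_onW (lexx s) te (hy i)) (fun i => vderiv_onW (lexx s) te (hw i))).
- by move=> i /negPf iota_i; rewrite !ctrl iota_i.
- rewrite !ctrl eqxx; apply: control_gap => //; first exact: ltW.
  exact: ltW (lt_le_trans hW Wxi).
- move=> r i j /lim hr; apply: le_trans (dist_le_spread N0 _ _ _) _.
  have h1 : sqW r <= 3 / 2 * sqV 0.
    by apply: le_trans W0V0; rewrite ler_wsqrtr// (nW r hr).2.
  have := ler_pM (sqrtr_ge0 _) _ (sqrt2_le R) (ler_wpM2l sN0 h1).
  rewrite (mulr_ge0 sN0 (sqrtr_ge0 _)) => /(_ isT).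
  by rewrite /om; lra.
- move=> r i j hr; have /andP[r0 re] := lim _ hr.
  apply: weak_JL_gap => //.
  + by rewrite divr_ge0// addr_ge0 ?sqrtr_ge0.
  + apply: le_trans (dist_le_spread N0 _ _ _) _.
    rewrite mulrCA ler_wpM2l//.
    apply: le_trans (ler_wpM2l (sqrtr_ge0 _) (nX r (lim _ hr))) _.
    rewrite mulrDr (sqrtrM X0)// lerD2l.
    apply: ler_pM; [exact: sqrtr_ge0|by rewrite mulr_ge0 ?sqrtr_ge0|exact: sqrt2_le|].
    by rewrite ler_wpM2r ?sqrtr_ge0// (le_trans re).
  + by apply: JL1; rewrite r0 (le_trans re).
exact: progress_err hn _ ss.
Qed.

Lemma progress_upto n : (forall m, (m < n)%N -> 2 * Delta < sqW (m%:R * tau)) ->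
  progress n.
Proof.
elim: n => [_|n IH h]; first exact: progress0.
by apply: progress_step (h n (ltnSn n)); apply: IH => m mn; exact/h/ltnW.
Qed.

(** If the threshold were never reached, the invariant would hold at all samples and confine every
    sampling time to [That]. *)
Lemma active_stops : exists n : nat, sqW (n%:R * tau) <= 2 * Delta.
Proof.
apply: contrapT => /forallNP h.
have {}h n : 2 * Delta < sqW (n%:R * tau) by rewrite ltNge; exact/negP/h.
pose n := Num.bound (That / tau).
have := active_time (progress_upto (fun m _ => h m)) (h n).
rewrite -ler_pdivlMr// leNgt => /negP; apply.
by rewrite archi_boundP// divr_ge0// ltW.
Qed.

(** Agent by agent, both weak alternatives give the bound [hV]. Squared and averaged, it gives at
    most [34 * Delta ^+ 2], within the allowed 72. *)
Lemma active_stop_V n : progress n.+1 -> n%:R * tau <= That ->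
  sqW (n.+1%:R * tau) <= 2 * Delta -> sqV (n.+1%:R * tau) <= Num.sqrt 72 * Delta.
Proof.
move=> hn nT hW; set t := n.+1%:R * tau in hn hW *.
have t0 : 0 <= t by rewrite mulr_ge0 ?ler0n// ltW.
have tT : t <= T by rewrite /t -natr1 mulrDl mul1r lerD2r.
have hV i : enorm (perp (v t) i) <= 2 * enorm (perp (w t) i) + Delta.
  have gap : enorm (M *m perp (v t) i - perp (w t) i) <= Delta / 2.
    by apply: projection_gap; rewrite ?t0//; apply: (progress_err hn); rewrite t0 lexx.
  have : weak_JL M eps Delta (perp (v t) i).
    (* The stopping sample may lie beyond [That]; it is the extra index [Num.floor (That / tau) + 1]
       of the assumption. *)
    apply: JL2; rewrite -addn1 PoszD lerD2r; exact: sample_le_floor.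
  have e2 := ler_wpM2r (enorm_ge0 (perp (v t) i)) eps_le_half.
  have := le_trans (enorm_leB _ _) gap; rewrite ler_norml => /andP[_ h].
  have w0 := enorm_ge0 (perp (w t) i).
  by case=> [[l _]|[l _]]; [move: l; rewrite mulrBl; lra|lra].
have VW : spread (v t) <= 8 * spread (w t) + 2 * Delta ^+ 2.
  rewrite !spreadE//.
  have -> : 8 * (N%:R^-1 * \sum_i enorm (perp (w t) i) ^+ 2) + 2 * Delta ^+ 2 =
     N%:R^-1 * \sum_(i < N) (8 * enorm (perp (w t) i) ^+ 2 + 2 * Delta ^+ 2).
    rewrite big_split/= -mulr_sumr sumr_const card_ord -mulr_natl.
    by field; rewrite gt_eqF.
  rewrite ler_wpM2l ?invr_ge0 ?ler0n//; apply: ler_sum => i _.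
  have := enorm_ge0 (perp (v t) i); have := hV i.
  have := sqr_ge0 (2 * enorm (perp (w t) i) - Delta); have := enorm_ge0 (perp (w t) i).
  move: (enorm (perp (v t) i)) (enorm (perp (w t) i)) => q p p0 sq h q0.
  have h2 : q ^+ 2 <= (2 * p + Delta) ^+ 2 by rewrite lerXn2r ?nnegrE// (le_trans q0 h).
  nra.
have WD : spread (w t) <= (2 * Delta) ^+ 2.
  rewrite -(sqr_sqrtr (spread_ge0 N0 (w t))) lerXn2r ?nnegrE ?sqrtr_ge0//.
  by rewrite mulr_ge0// ltW.
rewrite -[X in _ * X]ger0_norm ?(ltW D0)// -sqrtr_sqr -sqrtrM// ler_wsqrtr//.
by have := sqr_ge0 Delta; nra.
Qed.

End Active.

Let sum_sqr_le (p q r : R) : 0 <= p -> Num.sqrt p <= q + r ->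
  p <= 2 * q ^+ 2 + 2 * r ^+ 2.
Proof.
move=> p0 h; rewrite -(sqr_sqrtr p0); have s0 := sqrtr_ge0 p.
have h2 : Num.sqrt p ^+ 2 <= (q + r) ^+ 2 by rewrite lerXn2r ?nnegrE// (le_trans s0 h).
have := sqr_ge0 (q - r); nra.
Qed.

Lemma sampled_stop_exists : exists n : nat, sqW (n%:R * tau) <= 2 * Delta.
Proof.
have [W0|W0] := leP (sqW 0) (2 * Delta); first by exists 0%N; rewrite mul0r.
exact: active_stops.
Qed.

Lemma sampled_stop n : (forall m, (m < n)%N -> 2 * Delta < sqW (m%:R * tau)) ->
  sqW (n%:R * tau) <= 2 * Delta ->
  [/\ sqV (n%:R * tau) <= Num.sqrt 72 * Delta,
      forall t, 0 <= t <= n%:R * tau ->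
        spread (x t) <= 2 * X0 + 2 * (17 * N%:R / theta * V0) ^+ 2,
      spread (y (n%:R * tau)) <= 4 * (2 * X0 + 2 * (17 * N%:R / theta * V0) ^+ 2),
      2 * Delta <= sqW 0 ->
        n%:R * tau <= 2 * N%:R / theta * (sqW 0 - 2 * Delta) + tau
    & forall t, 0 <= t <= n%:R * tau -> spread (v t) <= V0].
Proof.
have X00 := spread_ge0 N0 (x 0); have V00 := spread_ge0 N0 (v 0).
have Y00 := spread_ge0 N0 (y 0); have W00 := spread_ge0 N0 (w 0).
have [WV VW YX] := init_bounds.
have sq2 := sqr_ge0 (17 * N%:R / theta * V0).
have hD := D0.
have Y0X0 : spread (y 0) <= 9 / 4 * X0.
  rewrite -(sqr_sqrtr X00) -(sqr_sqrtr Y00).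
  have := sqrtr_ge0 (spread (y 0)); have := sqrtr_ge0 X0; nra.
have W0V0 : spread (w 0) <= 9 / 4 * V0.
  rewrite -(sqr_sqrtr V00) -(sqr_sqrtr W00).
  have := sqrtr_ge0 (spread (w 0)); have := sqrtr_ge0 V0; nra.
case: n => [_|n hlt].
  rewrite mul0r => W0; split=> //.
  (* No interval has elapsed: the initial comparison gives [sqV 0 <= 2 * sqW 0 <= 4 * Delta], and 4
     is below the square root of 72. *)
  - apply: le_trans VW (le_trans (_ : _ <= 4 * Delta) _); first lra.
    rewrite ler_wpM2r ?(ltW D0)// -[leLHS]ger0_norm// -sqrtr_sqr ler_wsqrtr//; lra.
  - by move=> t /le_anti <-; lra.
  - lra.
  - move=> W1; rewrite addr_ge0 ?(ltW tau0)// mulr_ge0 ?subr_ge0//.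
    by rewrite divr_ge0 ?(ltW th0)// mulr_ge0.
  - by move=> t /le_anti <-.
have W0 : 2 * Delta < sqW 0 by have := hlt 0%N isT; rewrite mul0r.
have hn := progress_upto W0 hlt.
have hn' : progress n by apply: progress_upto => // m mn; apply: hlt; exact: ltnW.
have nT := active_time hn' (hlt n (ltnSn n)).
have ntau0 : 0 <= n.+1%:R * tau by rewrite mulr_ge0 ?ler0n// ltW.
have tt : 0 <= n.+1%:R * tau <= n.+1%:R * tau by rewrite ntau0 lexx.
have c0 : 0 <= N%:R / theta by rewrite divr_ge0 ?ler0n ?ltW.
move=> Wn; split.
- exact: active_stop_V.
- move=> t /(progress_XV hn) h.
  (* Dropping the V term and squaring the sum produces the two factors 2 of Xbar. *)
  rewrite -[X in 2 * X + _](sqr_sqrtr X00); apply: sum_sqr_le; first exact: spread_ge0.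
  apply: le_trans h; rewrite lerDl mulr_ge0 ?spread_ge0//.
  by rewrite -mulrA mulr_ge0.
- have h := progress_YW hn tt.
  have h1 : sqY (n.+1%:R * tau) <= sqY 0 + N%:R / theta * spread (w 0).
    by apply: le_trans h; rewrite lerDl mulr_ge0 ?spread_ge0.
  have := sum_sqr_le (spread_ge0 N0 _) h1; rewrite sqr_sqrtr//.
  have h2 := ler_wpM2l c0 W0V0.
  have h3 : (N%:R / theta * spread (w 0)) ^+ 2 <= (N%:R / theta * (9 / 4 * V0)) ^+ 2.
    have l0 := mulr_ge0 c0 W00.
    by rewrite lerXn2r ?nnegrE// (le_trans l0).
  move=> h4; apply: (le_trans h4).
  have -> : 17 * N%:R / theta * V0 = 17 * (N%:R / theta * V0) by field; rewrite gt_eqF.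
  have : 0 <= (N%:R / theta * V0) ^+ 2 by exact: sqr_ge0.
  have e1 : (N%:R / theta * (9 / 4 * V0)) ^+ 2 = 81 / 16 * (N%:R / theta * V0) ^+ 2.
    by field; rewrite gt_eqF.
  rewrite e1 in h3; rewrite (exprMn _ 17); lra.
(* The rate is applied at the preceding sample, where W still exceeds the threshold; the last
   interval costs one more [tau]. *)
- move=> _; rewrite -natr1 mulrDl mul1r lerD2r.
  have := progress_rate hn'; have := hlt n (ltnSn n).
  move: (sqW (n%:R * tau)) => z h1 h2.
  have -> : n%:R * tau = 2 * N%:R / theta * (theta / (2 * N%:R) * (n%:R * tau)).
    by field; rewrite !gt_eqF.
  rewrite ler_wpM2l ?divr_ge0 ?mulr_ge0 ?ler0n ?(ltW th0)//; lra.
- exact: progress_V hn.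
Qed.

End Consensus.

(** * Consensus region and final bounds *)

Theorem theorem4p5 (R : realType) (N d k : nat)
  (hN : (0 < N)%N) (hd : (0 < d)%N) (hk : (0 < k)%N) (hkd : (k <= d)%N)
  (theta : R) (htheta : 0 < theta)
  (a : R -> R) (La : R)
  (ha_pos : forall r : R, 0 <= r -> 0 < a r)
  (ha_mono : forall r s : R, 0 <= r -> r <= s -> a s <= a r)
  (ha_lip : La.-lipschitz_[set r : R | 0 <= r] a)
  (x0 v0 : 'I_N -> 'cV[R]_d)
  (c C : R) (hc : c = 1 / Num.sqrt 289) (hC : C = Num.sqrt 72)
  (X0 V0 : R) (hX0 : X0 = spread x0) (hV0 : V0 = spread v0)
  (Xbar : R)
  (hXbar : Xbar = 2 * X0 + 2 * N%:R ^+ 2 / (c ^+ 2 * theta ^+ 2) * V0 ^+ 2)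
  (Delta : R)
  (hDelta : Delta%:E = mine ((C^-1)%:E * gamma N a Xbar)%E
                            ((2^-1)%:E * gamma N a (4 * Xbar))%E)
  (That : R)
  (hThat : That = 2 * N%:R / theta * (2 * Num.sqrt V0 - 2 * Delta))
  (tau0 : R) (htau0 : 0 < tau0)
  (htau0_small : tau0 * (a 0 * Num.sqrt N%:R * Num.sqrt V0 + theta)
                 + tau0 ^+ 2 * a 0 * theta <= Delta / 4)
  (tau : R) (htau : 0 < tau) (htau_le : tau <= tau0)
  (M : 'M[R]_(k, d))
  (x v : R -> 'I_N -> 'cV[R]_d) (y w : R -> 'I_N -> 'cV[R]_k)
  (hxv : sampling_solution a tau
           (sparse_control theta ((2 * Delta) ^+ 2) w v) x0 v0 x v)
  (hyw : sampling_solution a tau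
           (sparse_control theta ((2 * Delta) ^+ 2) w w)
           (fun i => M *m x0 i) (fun i => M *m v0 i) y w)
  (alpha : R) (halpha : alpha = Num.sqrt 2 * N%:R / (c * theta))
  (eps : R) (heps0 : 0 < eps) (heps1 : eps < 1)
  (heps_small :
     eps * Num.sqrt N%:R
     * (4 * La * Num.sqrt (N%:R * V0) * (Num.sqrt (2 * X0) + alpha)
        + theta / Num.sqrt N%:R)
     * (That + tau)
     * expR ((That + tau)
             * (Num.max (2 * a 0 + 1) (4 * La * Num.sqrt (N%:R * V0))
                + 8 * theta / Delta))
     <= Delta / 2)
  (hJL1 : forall (i j : 'I_N) (t : R), 0 <= t <= That + tau ->
     weak_JL M eps (eps * ((Num.sqrt (2 * X0) + alpha) / 2)) (x t i - x t j))
  (hJL2 : forall (i : 'I_N) (n : nat),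
     (n%:Z <= Num.floor (That / tau) + 1)%R ->
     weak_JL M eps Delta (v (n%:R * tau) i - mean (v (n%:R * tau))))
  (hJL3 : forall i : 'I_N,
     strong_JL M (1 / 2) (v 0 i - mean (v 0)) /\
     strong_JL M (1 / 2) (x 0 i - mean (x 0))) :
  (exists n : nat, Num.sqrt (spread (w (n%:R * tau))) <= 2 * Delta) /\
  (forall (nstar : nat) (T0 : R),
     Num.sqrt (spread (w (nstar%:R * tau))) <= 2 * Delta ->
     (forall n : nat, Num.sqrt (spread (w (n%:R * tau))) <= 2 * Delta ->
        (nstar <= n)%N) ->
     T0 = nstar%:R * tau ->
     [/\ ((Num.sqrt (spread (v T0)))%:E <= gamma N a (spread (x T0)))%E /\
         ((Num.sqrt (spread (w T0)))%:E <= gamma N a (spread (y T0)))%E,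
         2 * Delta <= Num.sqrt (spread (w 0)) ->
           T0 <= 2 * N%:R / theta
                 * (Num.sqrt (spread (w 0)) - 2 * Delta) + tau,
         2 * N%:R / theta * (Num.sqrt (spread (w 0)) - 2 * Delta) + tau
           <= That + tau,
         forall (t : R) (i j : 'I_N), 0 <= t <= T0 ->
           enorm (x t i - x t j) <= 2 * Num.sqrt (N%:R * Xbar)
       & forall (t : R) (i j : 'I_N), 0 <= t <= T0 ->
           enorm (v t i - v t j) <= 2 * Num.sqrt (N%:R * V0)]).
Proof.
have NR0 : 0 < N%:R :> R by rewrite ltr0n.
have s289 : Num.sqrt 289 = 17 :> R.
  have -> : (289 : R) = 17 ^+ 2 by ring.
  by rewrite sqrtr_sqr ger0_norm.
have {}hc : c = 1 / 17 by rewrite hc s289.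
have tau00 := ltW htau.
have ha0 : 0 < a 0 by exact: ha_pos.
have xE : x 0 = x0 by case: hxv => h _ _; apply/funext => i; have [] := h i.
have vE : v 0 = v0 by case: hxv => h _ _; apply/funext => i; have [] := h i.
rewrite -xE in hX0; rewrite -vE in hV0.
have X0_ge0 : 0 <= X0 by rewrite hX0 spread_ge0.
have V0_ge0 : 0 <= V0 by rewrite hV0 spread_ge0.
have hlip r s : 0 <= r -> 0 <= s -> `|a r - a s| <= La * `|r - s|.
  by move=> r0 s0; exact: (ha_lip (r, s)).
have La0 : 0 <= La.
  have := hlip 1 0 ler01 (lexx 0); rewrite subr0 normr1 mulr1.
  exact: le_trans (normr_ge0 _).
(* Positivity of [Delta] is read off the condition on [tau0], whose left side is positive. *)
have D0 : 0 < Delta.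
  have : 0 < Delta / 4.
    apply: lt_le_trans htau0_small; apply: ltr_pwDl.
      by rewrite mulr_gt0// ltr_wpDl// !mulr_ge0 ?sqrtr_ge0// ltW.
    by rewrite !mulr_ge0 ?sqr_ge0// ltW.
  by rewrite pmulr_lgt0// invr_gt0.
have htau' : tau * (a 0 * Num.sqrt N%:R * Num.sqrt (spread (v 0)) + theta)
    + tau ^+ 2 * a 0 * theta <= Delta / 4.
  apply: le_trans htau0_small; rewrite -hV0; apply: lerD.
    by rewrite ler_wpM2r// addr_ge0 ?(ltW htheta)// !mulr_ge0 ?sqrtr_ge0 ?(ltW ha0).
  rewrite ler_wpM2r ?(ltW htheta)// ler_wpM2r ?(ltW ha0)//.
  by rewrite lerXn2r// nnegrE ltW.
have alpha0 : 0 <= alpha.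
  by rewrite halpha hc divr_ge0 ?mulr_ge0 ?sqrtr_ge0 ?ler0n// ltW.
have XbarE : Xbar = 2 * X0 + 2 * (17 * N%:R / theta * V0) ^+ 2.
  by rewrite hXbar hc; field; rewrite gt_eqF.
have X0_le : X0 <= Xbar by rewrite XbarE; have := sqr_ge0 (17 * N%:R / theta * V0); lra.
have gmono := @gamma_le R N a ha_pos ha_mono.
have hC0 : 0 < C by rewrite hC sqrtr_gt0.
(* The minimum is taken in the extended reals, so an infinite tail integral needs no separate
   case. *)
have gC : ((C * Delta)%:E <= gamma N a Xbar)%E.
  have : (Delta%:E <= (C^-1)%:E * gamma N a Xbar)%E by rewrite hDelta ge_min lexx.
  by rewrite lee_pdivlMl// EFinM.
have g2 : ((2 * Delta)%:E <= gamma N a (4 * Xbar))%E.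
  have : (Delta%:E <= (2^-1)%:E * gamma N a (4 * Xbar))%E.
    by rewrite hDelta ge_min lexx orbT.
  by rewrite lee_pdivlMl// EFinM.
rewrite hV0 hX0 in heps_small hJL1 hThat.
rewrite -xE -vE in hxv; rewrite -xE -vE in hyw.
have JL3v i : strong_JL M (1 / 2) (perp (v 0) i) by have [] := hJL3 i.
have JL3x i : strong_JL M (1 / 2) (perp (x 0) i) by have [] := hJL3 i.
have [n0 hn0] := sampled_stop_exists hN htheta ha_pos ha_mono La0 hlip D0 htau htau' hThat
  alpha0 (ltW heps0) hxv hyw heps_small hJL1 hJL2 JL3v JL3x.
have [WV _ _] := init_bounds hN hyw JL3v JL3x.
split; first by exists n0.
move=> nstar T0 hstar hmin T0E.
have hlt m : (m < nstar)%N -> 2 * Delta < Num.sqrt (spread (w (m%:R * tau))).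
  by rewrite ltNge => mn; apply/negP => /hmin; rewrite leqNgt mn.
have := sampled_stop hN htheta ha_pos ha_mono La0 hlip D0 htau htau' hThat
  alpha0 (ltW heps0) hxv hyw heps_small hJL1 hJL2 JL3v JL3x hlt hstar.
rewrite -hV0 -hX0 -XbarE -T0E => -[hV hX hY hT hVt].
have T00 : 0 <= T0 <= T0 by rewrite T0E mulr_ge0 ?ler0n ?lexx.
have dist (m : nat) (z : 'I_N -> 'cV[R]_m) (S : R) i j : spread z <= S ->
    enorm (z i - z j) <= 2 * Num.sqrt (N%:R * S).
  move=> zS; apply: le_trans (dist_le_spread hN _ _ _) _.
  rewrite (sqrtrM S) ?ler0n//; apply: ler_pM; rewrite ?mulr_ge0 ?sqrtr_ge0//.
    by have := sqrt2_le R; lra.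
  by rewrite ler_wpM2l ?sqrtr_ge0// ler_wsqrtr.
split.
(* [gamma] is non-increasing, so its values at [Xbar] and [4 * Xbar] lie below those at the actual
   spreads at [T0]. *)
- split.
    apply: (@le_trans _ _ (C * Delta)%:E); first by rewrite lee_fin hC.
    by apply: le_trans gC _; apply: gmono; exact: hX.
  apply: (@le_trans _ _ (2 * Delta)%:E); first by rewrite lee_fin T0E.
  by apply: le_trans g2 _; exact: gmono.
- exact: hT.
(* [sqrt W(0)] is at most 3/2 of [sqrt V(0)], hence below the factor 2 in [That]. *)
- rewrite hThat lerD2r ler_wpM2l ?divr_ge0 ?mulr_ge0 ?ler0n ?(ltW htheta)//.
  have := sqrtr_ge0 (spread (v 0)); lra.
- by move=> t i j /hX; exact: dist.
- by move=> t i j /hVt; exact: dist.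
Qed.
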